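(* Let $N\ge 2$ be an integer, $p\ge 1$, $x_0\in\mathbb{R}^N$, $r>0$, $c>0$, $\alpha\in(0,1)$, $\gamma'>0$, and $\delta,\lambda\in(0,1)$. Then there exists $\eta\in(0,1)$, independent of $u$ (i.e. determined by the data just listed), such that the following holds. For every $u\in W^{1,p}(Q_r(x_0))$ satisfying (a) $\big|\{x\in Q_r(x_0):\,u(x)>c\}\big| > \alpha r^N$, and (b$'$) $\|\nabla u\|_{p,Q_r(x_0)} \le \gamma'\, c\, r^{\frac{N-p}{p}}$, there exists a point $x_1\in Q_r(x_0)$ such that $$\big|\{x\in Q_{\eta r}(x_1):\,u(x)>\lambda c\}\big| > (1-\delta)(\eta r)^N.$$
   Context: For $x\in\mathbb{R}^N$ and $r>0$, $Q_r(x)=\prod_{i=1}^N\big(x^i-\frac r2,\,x^i+\frac r2\big)$ is the open cube centered at $x$ with side $r$. $|A|$ denotes the $N$-dimensional Lebesgue measure of $A\subset\mathbb{R}^N$. $W^{1,p}(\Omega)$ is the usual Sobolev space of real-valued functions on the open set $\Omega\subset\mathbb{R}^N$, and $$\|\nabla u\|_{p,\Omega}=\Big[\int_\Omega|\nabla u(x)|^p\,dx\Big]^{\frac1p}.$$ Since $u$ is defined only on $Q_r(x_0)$, the set $\{x\in Q_{\eta r}(x_1):\,u(x)>\lambda c\}$ is understood as a subset of $Q_{\eta r}(x_1)\cap Q_r(x_0)$. *)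

(* Defs.v *)
From HB Require Import structures.
From mathcomp Require Import all_boot all_order all_algebra.
From mathcomp Require Import all_classical all_reals all_analysis.
Set Implicit Arguments.
Unset Strict Implicit.
Unset Printing Implicit Defensive.
Import Order.TTheory GRing.Theory Num.Theory.
Import numFieldNormedType.Exports.
Local Open Scope classical_set_scope.
Local Open Scope ring_scope.

Definition rV_display : measure_display.
Proof. exact: default_measure_display. Qed.

Section rV_measurable.
Context (R : realType) (n : nat).

Let coord (i : 'I_n) (x : 'rV[R]_n) : R := x ord0 i.

Let rV_set0 : g_sigma_preimage coord set0.
Proof. exact: sigma_algebra0. Qed.

Let rV_setC A : g_sigma_preimage coord A -> g_sigma_preimage coord (~` A).
Proof. exact: sigma_algebraC. Qed.

Let rV_bigcup (F : (set 'rV[R]_n)^nat) :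
  (forall i, g_sigma_preimage coord (F i)) ->
  g_sigma_preimage coord (\bigcup_i (F i)).
Proof. exact: sigma_algebra_bigcup. Qed.

(* The Borel sigma-algebra of R^n: it is generated by the coordinate maps. *)
HB.instance Definition _ := @isMeasurable.Build rV_display
  'rV[R]_n (g_sigma_preimage coord) rV_set0 rV_setC rV_bigcup.

End rV_measurable.

Section rV_measurable_lemmas.
Context (R : realType).

Lemma measurable_coord n (i : 'I_n) :
  measurable_fun [set: 'rV[R]_n] (fun x : 'rV[R]_n => x ord0 i).
Proof.
move=> _ Y mY; rewrite setTI; apply: sub_sigma_algebra => /=.
rewrite -bigcup_seq/=; exists i => /=; first by rewrite mem_index_enum.
by exists Y => //; rewrite setTI.
Qed.

Lemma measurable_fun_rV d (T : measurableType d) n (f : T -> 'rV[R]_n) :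
  (forall i, measurable_fun [set: T] (fun t => f t ord0 i)) ->
  measurable_fun [set: T] f.
Proof.
move=> mf _ A mA; rewrite setTI.
suff : @measurable _ 'rV[R]_n `<=` [set B | measurable (f @^-1` B)] by exact.
apply: smallest_sub => [|B].
  split => [|B mB|F mF] /=.
  - by rewrite preimage_set0; exact: measurable0.
  - by rewrite setTD preimage_setC; exact: measurableC.
  - by rewrite preimage_bigcup; exact: bigcupT_measurable.
rewrite -bigcup_seq => -[i _ [C mC <-]] /=.
by rewrite setTI -comp_preimage -[X in measurable X]setTI; exact: mf.
Qed.

Definition rV_cons n (p : measurableTypeR R * 'rV[R]_n) : 'rV[R]_n.+1 :=
  \row_i oapp (p.2 ord0) p.1 (unlift ord0 i).

Definition rV_uncons n (x : 'rV[R]_n.+1) : measurableTypeR R * 'rV[R]_n :=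
  (x ord0 ord0, \row_i x ord0 (lift ord0 i)).

Lemma rV_consK n : cancel (@rV_cons n) (@rV_uncons n).
Proof.
case=> t x; rewrite /rV_uncons mxE unlift_none; congr (_, _).
by apply/rowP => i; rewrite !mxE liftK.
Qed.

Lemma measurable_rV_cons n : measurable_fun [set: _ * _] (@rV_cons n).
Proof.
apply: measurable_fun_rV => i; rewrite /rV_cons.
under eq_fun do rewrite mxE.
case: unliftP => [j|] _ /=; last exact: measurable_fst.
exact: measurableT_comp (measurable_coord j) measurable_snd.
Qed.

Lemma measurable_rV_uncons n : measurable_fun [set: 'rV[R]_n.+1] (@rV_uncons n).
Proof.
apply/measurable_fun_pairP; split; first exact: measurable_coord.
apply: measurable_fun_rV => i /=.
by under eq_fun do rewrite mxE; exact: measurable_coord.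
Qed.

End rV_measurable_lemmas.

Section lebesgue_rV_step.
Local Open Scope ereal_scope.
Context (R : realType) (n : nat).
Variable m : {sigma_finite_measure set 'rV[R]_n -> \bar R}.

Definition lebesgue_rV_step : set 'rV[R]_n.+1 -> \bar R :=
  pushforward (lebesgue_measure \x m) (@rV_cons R n).

Let mpre (A : set 'rV[R]_n.+1) : measurable A ->
  measurable (@rV_cons R n @^-1` A).
Proof.
move=> mA; rewrite -[X in measurable X]setTI.
exact: (@measurable_rV_cons R n measurableT).
Qed.

Let step0 : lebesgue_rV_step set0 = 0.
Proof. by rewrite /lebesgue_rV_step /pushforward preimage_set0 measure0. Qed.

Let step_ge0 A : 0 <= lebesgue_rV_step A.
Proof. exact: (measure_ge0 (lebesgue_measure \x m)). Qed.

Let step_sigma_additive : semi_sigma_additive lebesgue_rV_step.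
Proof.
move=> F mF tF mUF; rewrite /lebesgue_rV_step /pushforward preimage_bigcup.
apply: measure_semi_sigma_additive.
- by move=> k; exact: mpre.
- apply/trivIsetP => /= i j _ _ ij; rewrite -preimage_setI.
  by move/trivIsetP : tF => /(_ _ _ _ _ ij) ->//; rewrite preimage_set0.
- by rewrite -preimage_bigcup; exact: mpre.
Qed.

HB.instance Definition _ := isMeasure.Build _ _ _ lebesgue_rV_step
  step0 step_ge0 step_sigma_additive.

Let step_sigma_finite : sigma_finite setT lebesgue_rV_step.
Proof.
have /sigma_finiteP[F [FT ndF Foo]] := sigma_finiteT (@lebesgue_measure R).
have /sigma_finiteP[G [GT ndG Goo]] := sigma_finiteT m.
exists (fun k => @rV_uncons R n @^-1` (F k `*` G k)).
  rewrite -preimage_bigcup (_ : \bigcup_k _ = setT) ?preimage_setT//.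
  apply/seteqP; split => // -[x y] _.
  have : (setT : set (measurableTypeR R)) x by [].
  rewrite FT => -[i _ Fix]; have : setT y by [].
  rewrite GT => -[j _ Gjy]; exists (maxn i j) => //; split.
  - by move: x Fix; exact/subsetPset/ndF/leq_maxl.
  - by move: y Gjy; exact/subsetPset/ndG/leq_maxr.
move=> k; have [mF Fk] := Foo k; have [mG Gk] := Goo k; split.
  rewrite -[X in measurable X]setTI.
  by apply: (@measurable_rV_uncons R n measurableT); exact: measurableX.
rewrite /lebesgue_rV_step /pushforward -comp_preimage.
rewrite (_ : _ \o _ = idfun); last by apply/funext => p /=; rewrite rV_consK.
by rewrite preimage_id product_measure1E// lte_mul_pinfty// ge0_fin_numE.
Qed.

HB.instance Definition _ := Measure_isSigmaFinite.Build _ _ _ lebesgue_rV_step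
  step_sigma_finite.

End lebesgue_rV_step.

(* Lebesgue measure on the Borel sets of R^n, as the n-fold product of
   one-dimensional Lebesgue measure. *)
Fixpoint borel_lebesgue (R : realType) (n : nat) :
    {sigma_finite_measure set 'rV[R]_n -> \bar R} :=
  match n with
  | 0 => (\d_ (0 : 'rV[R]_0))
  | n.+1 => lebesgue_rV_step (borel_lebesgue R n)
  end.

(* R^n with the Lebesgue sigma-algebra: the Caratheodory-measurable sets of the
   outer measure of borel_lebesgue, that is, the completion of the Borel sets. *)
Definition lebesgue_rV_type (R : realType) (n : nat) : measurableType _ :=
  caratheodory_type ((borel_lebesgue R n)^*)%mu.

Definition lebesgue_rV (R : realType) (n : nat) :
    {measure set (lebesgue_rV_type R n) -> \bar R} :=
  @completed_measure_extension _ _ _ (borel_lebesgue R n).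

Section sobolev.
Context (R : realType) (N : nat).
Implicit Types (Omega : set 'rV[R]_N) (p : R) (u f g phi : 'rV[R]_N -> R).

(* Open cube centered at x with side r, not half-side r. *)
Definition cube (x : 'rV[R]_N) (r : R) : set 'rV[R]_N :=
  [set y | forall i, x ord0 i - r / 2 < y ord0 i < x ord0 i + r / 2].

(* The norm that the library puts on row vectors is the sup norm. *)
Definition euclidean_norm (v : 'rV[R]_N) : R :=
  Num.sqrt (\sum_i v ord0 i ^+ 2).

Definition partial (i : 'I_N) f : 'rV[R]_N -> R :=
  fun x => 'D_(delta_mx ord0 i) f x.

Definition smooth f := forall s : seq 'I_N,
  let g := foldr partial f s in
  continuous g /\ forall i x, derivable g x (delta_mx ord0 i).

Definition test_function Omega phi :=
  let K := closure [set x | phi x != 0] in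
  [/\ smooth phi, compact K & K `<=` Omega].

Definition locally_integrable_rV Omega f :=
  forall K, compact K -> K `<=` Omega ->
    (lebesgue_rV R N).-integrable K (EFin \o f).

Definition weak_partial Omega i u g :=
  [/\ locally_integrable_rV Omega u, locally_integrable_rV Omega g &
    forall phi, test_function Omega phi ->
      \int[lebesgue_rV R N]_(x in Omega) (u x * partial i phi x) =
      - \int[lebesgue_rV R N]_(x in Omega) (g x * phi x)].

Definition is_weak_gradient Omega u (G : 'rV[R]_N -> 'rV[R]_N) :=
  forall i, weak_partial Omega i u (fun x => G x ord0 i).

(* Weak gradients are unique up to a null set; this picks one. *)
Definition weak_gradient Omega u : 'rV[R]_N -> 'rV[R]_N :=
  xget (fun=> 0) [set G | is_weak_gradient Omega u G].

Definition Lp_fun Omega p f :=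
  measurable_fun (Omega : set (lebesgue_rV_type R N)) f /\
  (\int[lebesgue_rV R N]_(x in Omega) (`|f x| `^ p)%:E < +oo)%E.

Definition sobolev Omega p u :=
  Lp_fun Omega p u /\
  exists2 G, is_weak_gradient Omega u G &
    forall i, Lp_fun Omega p (fun x => G x ord0 i).

Definition gradient_norm Omega p u : \bar R :=
  ((\int[lebesgue_rV R N]_(x in Omega)
     (euclidean_norm (weak_gradient Omega u x) `^ p)%:E) `^ p^-1)%E.

End sobolev.

(* Main.v *)
(** A Poincare-type inequality follows directly from the definition of weak
    derivatives.  On a cube P of side l, fix a unit bump w_i in each coordinate.
    Take a smooth f with compact support in P and, one coordinate after the other,
    replace it by its integral along coordinate i times w_i.  The error made at
    step i has zero integral along coordinate i, so it is the i-th partial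
    derivative of a test function of size O(l sup|f|).  Testing u against these
    functions gives |int u f - c int f| <= K l sup|f| int_P |grad u|, where c is the
    integral of u against the product of the w_i, and by density f may be replaced
    by the indicator of any measurable subset of P.  Comparing two level sets
    {u > c} and {u <= lambda c} in P yields De Giorgi's isoperimetric inequality.

    Cut Q_r into (m+1)^N cubes of side l = r/(m+1).  If {u > lambda c} filled none of them
    up to the fraction delta, then |{u > c} in P| delta (1 - lambda) c <= K l int_P |grad u|
    for each of them; summing and using (b') bounds m by a constant that does not
    depend on u. *)

Require Import Defs.
From mathcomp Require Import all_boot all_order all_algebra.
From mathcomp Require Import all_classical all_reals all_analysis.
From mathcomp Require Import measurable_realfun ring lra.
Set Implicit Arguments.
Unset Strict Implicit.
Unset Printing Implicit Defensive.
Import Order.TTheory GRing.Theory Num.Theory.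
Import numFieldNormedType.Exports.
Local Open Scope classical_set_scope.
Local Open Scope ring_scope.

(** * Smooth functions of one variable *)

(** Two facts shape the argument: the gradient is known only through test functions, and [u] is only
    integrable. A test function keeps a positive distance from the faces of the cube, and this
    distance may shrink as the approximation of an indicator improves. The bumps [w] live in the
    middle half of each side, so they fit into all the shrunken boxes and no constant depends on
    that distance. Approximation is measured in L^1 with weight 1 + |u|: a single function then
    controls both the measure of a set and the integral of [u] over it. Density comes from a
    sigma-algebra argument, products and f -> 1 - f matching intersections and complements, in place
    of mollification. The exponent p enters through y <= t^(1-p) y^p + t. With t = gamma / r, where
    gamma = gamma' c, the bound on the p-norm becomes an L^1 bound 2 gamma r^(N-1) for each
    component of the gradient. After summation over the cells the local estimate keeps the factor l
    = r/(m+1), and this is the source of the smallness. *)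

Section smooth_functions_of_one_variable.
Context {R : realType}.
Implicit Types (h k : R -> R) (n : nat).

(** Each derivative is an existential witness instead of an iterated [derive1], so closure under
    sums, products and affine substitutions is an induction on [n] with explicit formulas;
    [smooth1_derive] leads back to [derive1]. *)
Fixpoint diffn n h : Prop :=
  if n is n'.+1 then
    exists2 h', (forall t : R, is_derive t 1 h (h' t)) & diffn n' h'
  else True.

Definition smooth1 h := forall n, diffn n h.

Lemma diffnW n h : diffn n.+1 h -> diffn n h.
Proof. by elim: n h => [//|n IH] h [h' dh /IH]; exists h'. Qed.

Lemma diffn_cst n (c : R) : diffn n (cst c).
Proof.
by elim: n c => [//|n IH] c; exists (cst 0) => // t; exact: is_derive_cst.
Qed.

Lemma diffnD n h k : diffn n h -> diffn n k -> diffn n (fun t => h t + k t).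
Proof.
elim: n h k => [//|n IH] h k [h' dh sh] [k' dk sk].
by exists (fun t => h' t + k' t); [move=> t; exact: is_deriveD | exact: IH].
Qed.

Lemma diffnM n h k : diffn n h -> diffn n k -> diffn n (fun t => h t * k t).
Proof.
elim: n h k => [//|n IH] h k hS kS.
have [h' dh sh] := hS; have [k' dk sk] := kS.
exists (fun t => h t * k' t + h' t * k t).
  move=> t; have -> : h t * k' t + h' t * k t = h t *: k' t + k t *: h' t.
    by rewrite /GRing.scale/= (mulrC (k t)).
  exact: is_deriveM.
by apply: diffnD; apply: IH => //; exact: diffnW.
Qed.

Lemma is_derive_affine (a b t : R) : is_derive t 1 (fun t : R => a * t + b) a.
Proof.
have -> : (fun t : R => a * t + b) = (a \*: id + cst b) by apply/funext.
by apply: is_derive_eq; rewrite addr0 /GRing.scale/= mulr1.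
Qed.

Lemma diffn_affine n h (a b : R) :
  diffn n h -> diffn n (fun t => h (a * t + b)).
Proof.
elim: n h => [//|n IH] h [h' dh sh].
exists (fun t => a * h' (a * t + b)); last first.
  by apply: (@diffnM _ (cst a)); [exact: diffn_cst | exact: IH].
move=> t; have da := is_derive_affine a b t.
rewrite mulrC; exact: (is_derive1_comp (f := h) (g := fun t : R => a * t + b)).
Qed.

Lemma smooth1_cst (c : R) : smooth1 (cst c).
Proof. by move=> n; exact: diffn_cst. Qed.

Lemma smooth1D h k : smooth1 h -> smooth1 k -> smooth1 (fun t => h t + k t).
Proof. by move=> sh sk n; exact: diffnD. Qed.

Lemma smooth1M h k : smooth1 h -> smooth1 k -> smooth1 (fun t => h t * k t).
Proof. by move=> sh sk n; exact: diffnM. Qed.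

Lemma smooth1Z c h : smooth1 h -> smooth1 (fun t => c * h t).
Proof. by move=> sh; apply: smooth1M => //; exact: smooth1_cst. Qed.

Lemma smooth1_affine h (a b : R) :
  smooth1 h -> smooth1 (fun t => h (a * t + b)).
Proof. by move=> sh n; exact: diffn_affine. Qed.

Lemma smooth1_is_derive h : smooth1 h -> forall t : R, is_derive t 1 h ((derive1 h) t).
Proof.
move=> /(_ 1%N)[h' dh _] t; have d := dh t.
by apply: DeriveDef; [exact: ex_derive | rewrite derive1E].
Qed.

Lemma smooth1_derive h : smooth1 h -> smooth1 (derive1 h).
Proof.
move=> sh n; have [h' dh] := sh n.+1.
suff -> : h' = (derive1 h) by [].
by apply/funext => t; rewrite derive1E; have := dh t => d; rewrite derive_val.
Qed.

Lemma smooth1_continuous h : smooth1 h -> continuous h.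
Proof.
move=> /(_ 1%N)[h' dh _] t; have d := dh t.
by apply: differentiable_continuous; apply/derivable1_diffP; exact: ex_derive.
Qed.

Lemma smooth1_primitive h k : smooth1 k ->
  (forall t : R, is_derive t 1 h (k t)) -> smooth1 h.
Proof. by move=> sk dh [//|n]; exists k. Qed.

End smooth_functions_of_one_variable.

(** * Flat exponentials t^(-n) exp(-1/t) *)

Section flat_exponential.
Context {R : realType}.
Implicit Types (t : R) (n : nat).

(** The power [n] is there to obtain a family stable under differentiation: the derivative of member
    n is a combination of members n+1 and n+2, so smoothness of all of them is one induction on the
    order. *)
Definition flat_exp n t : R := if 0 < t then t^-1 ^+ n * expR (- t^-1) else 0.

Lemma flat_exp_ge0 n t : 0 <= flat_exp n t.
Proof.
rewrite /flat_exp; case: ifPn => // t0.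
by rewrite mulr_ge0 ?expR_ge0// exprn_ge0// invr_ge0 ltW.
Qed.

(* With y = 1/t this is y^m <= m^m exp(y), that is y/m <= exp(y/m). *)
Lemma flat_exp_le n t : flat_exp n.+1 t <= n.+1%:R ^+ n.+1.
Proof.
rewrite /flat_exp; case: ifPn => t0; last by rewrite exprn_ge0.
set y := t^-1; have y0 : 0 < y by rewrite invr_gt0.
have m0 : (0 : R) < n.+1%:R by [].
rewrite expRN ler_pdivrMr ?expR_gt0//.
have {2}-> : y = n.+1%:R * (y / n.+1%:R) by rewrite mulrCA divff ?mulr1// gt_eqF.
rewrite expRM_natl -exprMn; apply: lerXn2r; rewrite ?nnegrE ?(ltW y0)//.
rewrite -ler_pdivrMl// mulrC (le_trans _ (expR_ge1Dx _))// lerDr//.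
Qed.

(** Two powers of 1/t are traded for the factor t^2, the remaining member n+2 being bounded. A
    quadratic bound makes the derivative at 0 exist and vanish. *)
Lemma flat_exp_le_sqr n t : `|flat_exp n t| <= n.+2%:R ^+ n.+2 * t ^+ 2.
Proof.
rewrite ger0_norm ?flat_exp_ge0//.
have -> : flat_exp n t = flat_exp n.+2 t * t ^+ 2.
  rewrite /flat_exp; case: ifPn => [t0|]; last by rewrite mul0r.
  by rewrite !exprS; field; rewrite gt_eqF.
by rewrite ler_wpM2r ?sqr_ge0// flat_exp_le.
Qed.

Lemma is_derive_quadratic_le (f : R -> R) (c : R) :
  (forall t, `|f t| <= c * t ^+ 2) -> is_derive (0 : R) 1 f 0.
Proof.
move=> fc.
have f0 : f 0 = 0.
  by apply/eqP; rewrite -normr_le0 (le_trans (fc 0))// expr0n mulr0.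
have c0 : 0 <= c by have := fc 1; rewrite expr1n mulr1; apply: le_trans.
suff cv : (fun t : R => t^-1 *: (f (t *: 1 + 0) - f 0)) @ 0^' --> (0 : R).
  apply: DeriveDef; first by apply/cvg_ex; exists 0.
  exact/cvg_lim.
apply/cvgr0Pnorm_lt => e e0; near=> t.
have t0 : t != 0 by near: t; exact: nbhs_dnbhs_neq.
rewrite f0 subr0 addr0 /GRing.scale/= mulr1 normrM normfV.
rewrite mulrC ltr_pdivrMr ?normr_gt0// (le_lt_trans (fc t))//.
rewrite -real_normK ?num_real// expr2 mulrA ltr_pM2r ?normr_gt0//.
rewrite (@le_lt_trans _ _ ((c + 1) * `|t|))//.
  by rewrite ler_wpM2r// lerDl.
rewrite -ltr_pdivlMl; last by rewrite ltr_wpDl.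
near: t; apply: dnbhs0_lt; by rewrite mulr_gt0// invr_gt0 ltr_wpDl.
Unshelve. all: by end_near. Qed.

Lemma is_derive_flat_exp n t :
  is_derive t 1 (flat_exp n) (flat_exp n.+2 t + - n%:R * flat_exp n.+1 t).
Proof.
have [t0|t0|->] := ltgtP t 0.
- have e0 m : flat_exp m t = 0 by rewrite /flat_exp ltNge (ltW t0).
  rewrite !e0 mulr0 addr0.
  apply: (near_eq_is_derive (f := cst 0)); rewrite ?oner_eq0//.
    near=> s; rewrite /flat_exp ltNge ltW//.
    by near: s; exact: lt_nbhsl.
- have tn0 : t != 0 by rewrite gt_eqF.
  pose g := (fun s : R => s^-1 ^+ n * expR (- s^-1)).
  apply: (near_eq_is_derive (f := g)); rewrite ?oner_eq0//.
    near=> s; rewrite /flat_exp ifT//.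
    by near: s; exact: lt_nbhsr.
  have dV : is_derive t 1 (fun s : R => s^-1) (- t^-1 ^+ 2).
    have := @is_deriveV R id t 1 1 tn0 _.
    by rewrite /GRing.scale/= mulr1 exprVn; apply; exact: is_derive_id.
  rewrite /g /flat_exp t0.
  have dE : is_derive t 1 (fun s : R => expR (- s^-1)) (expR (- t^-1) * t^-1 ^+ 2).
    rewrite -[t^-1 ^+ 2]opprK.
    exact: (is_derive1_comp (f := expR) (g := fun s : R => - s^-1)).
  have dX : is_derive t 1 (fun s : R => s^-1 ^+ n) (n%:R * t^-1 ^+ n.-1 * - t^-1 ^+ 2).
    have := @is_deriveX R R (fun s : R => s^-1) n t 1 (- t^-1 ^+ 2) dV.
    by rewrite /GRing.scale/= exprfctE.
  have := is_deriveM dX dE.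
  rewrite /GRing.scale/=; set a := (X in is_derive _ _ _ X -> _).
  set b := (X in _ -> is_derive _ _ _ X); suff -> : a = b by [].
  (* The truncated exponent [n.-1] calls for a case split; at n = 0 its term is cancelled by the
     factor [n%:R]. *)
  rewrite /a /b; case: (n) => [|m]/=; first by rewrite !exprS !expr0; ring.
  by rewrite !exprS; ring.
- have -> : flat_exp n.+2 0 + - n%:R * flat_exp n.+1 0 = 0.
    by rewrite /flat_exp ltxx mulr0 addr0.
  exact: (is_derive_quadratic_le (flat_exp_le_sqr n)).
Unshelve. all: by end_near. Qed.

Lemma smooth1_flat_exp n : smooth1 (flat_exp n).
Proof.
move=> m; elim: m n => [//|m IH] n.
exists (fun t => flat_exp n.+2 t + - n%:R * flat_exp n.+1 t).
  by move=> t; exact: is_derive_flat_exp.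
apply: diffnD => //; apply: (@diffnM _ m (cst _)) => //.
exact: diffn_cst.
Qed.

End flat_exponential.

(** * Primitives of functions supported in an interval *)

Section primitive.
Context {R : realType}.
Notation mu := (@lebesgue_measure R).
Implicit Types (h : R -> R) (a b t : R).

Definition primitive h t : R := (\int[mu]_(x in `]-oo, t]) h x)%R.

Definition supp_in a b h := forall t, t <= a \/ b <= t -> h t = 0.

Lemma supp_in_integrable a b h (D : set R) : measurable D -> continuous h ->
  supp_in a b h -> mu.-integrable D (EFin \o h).
Proof.
move=> mD ch sh; suff : mu.-integrable setT (EFin \o h).
  by apply: integrableS.
have -> : EFin \o h = (EFin \o h) \_ `[a, b].
  apply/funext => t; rewrite patchE; case: ifPn => // /negP tab.
  rewrite /= sh//; have [//|ta] := leP t a; first by left.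
  right; apply/ltW; rewrite ltNge; apply/negP => tb; apply: tab.
  by rewrite inE/= in_itv/= (ltW ta).
apply/integrable_restrict => //; rewrite setTI.
apply: continuous_compact_integrable; first exact: segment_compact.
exact: continuous_subspaceT.
Qed.

Lemma is_derive_primitive a b h : continuous h -> supp_in a b h ->
  forall t, is_derive t 1 (primitive h) (h t).
Proof.
move=> ch sh t.
have [] := @continuous_FTC1 R h -oo%O t (t + 1) _ _ _ (ch t).
- by rewrite ltrDl.
- exact: supp_in_integrable sh.
- by rewrite ltNyr.
rewrite -/(primitive h) => dh e.
by apply: DeriveDef; [exact: dh | rewrite -derive1E; exact: e].
Qed.

Lemma primitive_left a b h t : supp_in a b h -> t <= a -> primitive h t = 0.
Proof.
move=> sh ta; rewrite /primitive (@eq_Rintegral _ _ _ mu _ (cst 0)); last first.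
  move=> x; rewrite inE/= in_itv/= => xt; rewrite /= sh//; left.
  exact: le_trans ta.
by rewrite /Rintegral integral0.
Qed.

Lemma primitive_right a b h t : supp_in a b h -> b <= t ->
  primitive h t = \int[mu]_x h x.
Proof.
move=> sh bt; rewrite /primitive Rintegral_mkcond; apply: eq_Rintegral => x _.
rewrite patchE; case: ifPn => // /negP; rewrite inE/= in_itv/= => xt.
by rewrite sh//; right; rewrite (le_trans bt)// ltW// ltNge; apply/negP.
Qed.

Lemma smooth1_primitive_supp a b h : smooth1 h -> supp_in a b h ->
  smooth1 (primitive h).
Proof.
move=> sh sup; apply: (smooth1_primitive sh).
by apply: is_derive_primitive sup; exact: smooth1_continuous.
Qed.

Lemma supp_in_primitive a b h : a <= b -> supp_in a b h ->
  \int[mu]_x h x = 0 -> supp_in a b (primitive h).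
Proof.
move=> ab sh h0 t [ta|bt]; first exact: primitive_left sh ta.
by rewrite (primitive_right sh bt).
Qed.

Lemma derive_le_abs_diff (f df : R -> R) (M a b : R) : a <= b ->
  (forall t, is_derive t 1 f (df t)) -> (forall t, `|df t| <= M) ->
  `|f b - f a| <= M * (b - a).
Proof.
move=> ab dfE dfM.
have [|c _ ->] := @MVT_segment R f df a b ab (fun t _ => dfE t).
  apply: continuous_subspaceT => t; have d := dfE t.
  by apply: differentiable_continuous; apply/derivable1_diffP; exact: ex_derive.
by rewrite normrM (@ger0_norm _ (b - a)) ?subr_ge0// ler_wpM2r ?subr_ge0.
Qed.

End primitive.

(** * Bumps and smooth steps *)

Section bump.
Context {R : realType}.
Notation mu := (@lebesgue_measure R).
Implicit Types (h : R -> R) (a b l t : R).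

Lemma primitive_nondecreasing a b h : continuous h -> supp_in a b h ->
  (forall t, 0 <= h t) -> {homo primitive h : s t / s <= t}.
Proof.
move=> ch sh h0 s t st.
have dh := is_derive_primitive ch sh.
have [|c _ e] := @MVT_segment R (primitive h) h s t st (fun t _ => dh t).
  apply: continuous_subspaceT => x; have d := dh x.
  by apply: differentiable_continuous; apply/derivable1_diffP; exact: ex_derive.
by rewrite -subr_ge0 e mulr_ge0// subr_ge0.
Qed.

Definition bump a b t : R := flat_exp 0 (t - a) * flat_exp 0 (b - t).

Lemma smooth1_bump a b : smooth1 (bump a b).
Proof.
apply: smooth1M.
  have -> : (fun t => flat_exp 0 (t - a)) = (fun t => flat_exp 0 (1 * t + - a)).
    by apply/funext => t; rewrite mul1r.
  by apply: smooth1_affine; exact: smooth1_flat_exp.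
have -> : (fun t => flat_exp 0 (b - t)) = (fun t => flat_exp 0 (-1 * t + b)).
  by apply/funext => t; rewrite mulN1r addrC.
by apply: smooth1_affine; exact: smooth1_flat_exp.
Qed.

Lemma supp_in_bump a b : supp_in a b (bump a b).
Proof.
move=> t tab; rewrite /bump /flat_exp !subr_gt0.
by case: tab => [ta|bt]; rewrite ?(ltNge a) ?ta ?mul0r// (ltNge t) bt mulr0.
Qed.

Lemma bump_ge0 a b t : 0 <= bump a b t.
Proof. by rewrite mulr_ge0// flat_exp_ge0. Qed.

Lemma bump_le1 a b t : bump a b t <= 1.
Proof.
have f1 (s : R) : flat_exp 0 s <= 1.
  rewrite /flat_exp expr0 mul1r; case: ifPn => // s0.
  by rewrite -expR0 ler_expR oppr_le0 invr_ge0 ltW.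
by rewrite mulr_ile1// flat_exp_ge0.
Qed.

Lemma bump_gt0 a b t : a < t < b -> 0 < bump a b t.
Proof.
move=> /andP[at0 tb]; rewrite /bump /flat_exp !subr_gt0 at0 tb !expr0 !mul1r.
by rewrite mulr_gt0 ?expR_gt0.
Qed.

Definition bump_mass a b : R := \int[mu]_x bump a b x.

(** The primitive is nondecreasing, and by the mean value theorem it increases strictly across the
    middle third of the interval, where the bump is positive. *)
Lemma bump_mass_gt0 a b : a < b -> 0 < bump_mass a b.
Proof.
move=> ab; rewrite /bump_mass.
have cb := smooth1_continuous (smooth1_bump a b).
have sb := @supp_in_bump a b.
have nd := primitive_nondecreasing cb sb (bump_ge0 a b).
have dh := is_derive_primitive cb sb.
rewrite -(primitive_right sb (lexx b)).
pose s := a + (b - a) / 3%:R; pose t := b - (b - a) / 3%:R.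
have st : s < t by rewrite /s /t; lra.
have [|c cst e] := @MVT R _ _ s t st (fun t _ => dh t).
  apply: continuous_subspaceT => x; have d := dh x.
  by apply: differentiable_continuous; apply/derivable1_diffP; exact: ex_derive.
have := nd a s; rewrite (primitive_left sb (lexx a)) => /(_ _) ps.
have tb : t <= b by rewrite /t; lra.
apply: lt_le_trans (nd _ _ tb).
rewrite -[X in 0 < X](subrK (primitive (bump a b) s)) e ltr_wpDr//.
  by apply: ps; rewrite /s; lra.
rewrite mulr_gt0 ?subr_gt0// bump_gt0//.
move: cst; rewrite in_itv/= => /andP[]; rewrite /s /t => *; apply/andP; split; lra.
Qed.

(** The primitive of [g] and the rescaled primitive [H] of [h] have the same derivative and both
    vanish at the left end of the support, hence they agree at the right end. *)
Lemma integral_rescale a b x l h : 0 < l -> a <= b -> smooth1 h -> supp_in a b h ->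
  \int[mu]_t (l^-1 * h (l^-1 * t + - (x / l))) = \int[mu]_t h t.
Proof.
move=> l0 ab sh suph.
have ln0 : l != 0 by rewrite gt_eqF.
set g := fun t => _.
have sg : smooth1 g by apply: smooth1Z; exact: smooth1_affine.
have supg : supp_in (x + l * a) (x + l * b) g.
  move=> t tab; rewrite /g suph ?mulr0//.
  have -> : l^-1 * t + - (x / l) = (t - x) / l by rewrite mulrBl mulrC.
  by rewrite ler_pdivrMr// ler_pdivlMr//; case: tab => ?; [left|right]; lra.
have lab : x + l * a <= x + l * b by rewrite lerD2l ler_pM2l.
rewrite -(primitive_right supg (lexx _)) -(primitive_right suph (lexx _)).
pose H t := primitive h (l^-1 * t + - (x / l)).
have H' t : is_derive t (1 : R) H (g t).
  have dh := is_derive_primitive (smooth1_continuous sh) suph.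
  have da := is_derive_affine l^-1 (- (x / l)) t.
  rewrite /g mulrC.
  exact: (is_derive1_comp (f := primitive h) (g := fun t : R => l^-1 * t + - (x / l))).
have G' := is_derive_primitive (smooth1_continuous sg) supg.
have e y : l^-1 * (x + l * y) + - (x / l) = y by field.
have Ha : H (x + l * a) = 0 by rewrite /H e (primitive_left suph (lexx _)).
have Hb : H (x + l * b) = primitive h b by rewrite /H e.
have D' t : is_derive t (1 : R) (fun t => primitive g t - H t) (cst 0 t).
  by rewrite /= -(subrr (g t)); exact: (is_deriveB (f := primitive g) (g := H)).
have D0 (t : R) : `|cst (0 : R) t| <= 0 by rewrite normr0.
have /= := derive_le_abs_diff lab D' D0.
rewrite mul0r Ha Hb (primitive_left supg (lexx _)) subrr subr0.
by rewrite normr_le0 subr_eq0 => /eqP.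
Qed.

(** One bump on [1/4, 3/4] is normalised and transported to every interval, so that [C], the inverse
    of its mass, is universal. The gap l/4 at both ends leaves room for all the margins used
    later. *)
Lemma unit_bump_exists : exists2 C : R, 0 < C & forall a l, 0 < l ->
  exists w : R -> R, [/\ smooth1 w, supp_in (a + l / 4%:R) (a + l - l / 4%:R) w,
    \int[mu]_t w t = 1 & forall t, 0 <= w t <= C / l].
Proof.
pose p : R := 4%:R^-1; pose q : R := 3%:R / 4%:R.
have pq : p < q by rewrite /p /q; lra.
have k0 := bump_mass_gt0 pq; set k := bump_mass p q in k0.
pose h t := k^-1 * bump p q t.
have sh : smooth1 h by apply: smooth1Z; exact: smooth1_bump.
have suph : supp_in p q h by move=> t tpq; rewrite /h supp_in_bump// mulr0.
exists k^-1; first by rewrite invr_gt0.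
move=> a l l0; have ln0 : l != 0 by rewrite gt_eqF.
exists (fun t => l^-1 * h (l^-1 * t + - (a / l))); split.
- by apply: smooth1Z; exact: smooth1_affine.
- move=> t tab; rewrite suph ?mulr0//.
  have -> : l^-1 * t + - (a / l) = (t - a) / l by rewrite mulrBl mulrC.
  by rewrite ler_pdivrMr// ler_pdivlMr// /p /q; case: tab => ?; [left|right]; lra.
- rewrite (integral_rescale _ l0 (ltW pq))// RintegralZl//; last first.
    apply: supp_in_integrable (@supp_in_bump p q) => //.
    exact/smooth1_continuous/smooth1_bump.
  by rewrite -/(bump_mass p q) -/k mulVf// gt_eqF.
- move=> t; have li : 0 < l^-1 by rewrite invr_gt0.
  have ki : 0 < k^-1 by rewrite invr_gt0.
  rewrite /h !mulr_ge0 ?(ltW li) ?(ltW ki) ?flat_exp_ge0 ?bump_ge0//=.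
  rewrite [leRHS]mulrC ler_pM2l// -[leRHS]mulr1 ler_pM2l//.
  exact: bump_le1.
Qed.

Definition smooth_step t : R := (bump_mass 0 1)^-1 * primitive (bump 0 1) t.

Lemma smooth1_step : smooth1 smooth_step.
Proof.
apply: smooth1Z; apply: smooth1_primitive_supp (@supp_in_bump 0 1).
exact: smooth1_bump.
Qed.

Lemma smooth_step_left t : t <= 0 -> smooth_step t = 0.
Proof.
by move=> t0; rewrite /smooth_step (primitive_left (@supp_in_bump 0 1))// mulr0.
Qed.

Lemma smooth_step_right t : 1 <= t -> smooth_step t = 1.
Proof.
move=> t1; rewrite /smooth_step (primitive_right (@supp_in_bump 0 1))//.
by rewrite mulVf// gt_eqF// bump_mass_gt0.
Qed.

Lemma smooth_step_itv t : 0 <= smooth_step t <= 1.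
Proof.
have nd : {homo smooth_step : s t / s <= t}.
  move=> x y xy; rewrite /smooth_step ler_pM2l ?invr_gt0 ?bump_mass_gt0//.
  have cb := smooth1_continuous (smooth1_bump 0 1).
  exact: (primitive_nondecreasing cb (@supp_in_bump 0 1) (bump_ge0 0 1)).
have [t0|t0] := leP t 0; first by rewrite smooth_step_left// lexx ler01.
rewrite -[X in X <= _ <= _](@smooth_step_left 0)// nd ?(ltW t0)//=.
have [t1|t1] := leP t 1; first by rewrite -(@smooth_step_right 1)// nd.
by rewrite smooth_step_right// ltW.
Qed.

End bump.

(** * Tensors of smooth functions *)

Section tensors.
Context {R : realType} {n : nat}.
Notation mu := (@lebesgue_measure R).
Implicit Types (i j : 'I_n) (x : 'rV[R]_n) (t : R).

(* Finite sums of products of functions of one variable: averages and primitives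
   along a coordinate then only affect the corresponding factors. *)
Definition tensor (I : finType) (h : I -> 'I_n -> R -> R) x : R :=
  \sum_k \prod_j h k j (x ord0 j).

Definition set_coord x i t : 'rV[R]_n :=
  \row_j (if j == i then t else x ord0 j).

Definition set_factor (h : 'I_n -> R -> R) i (f : R -> R) : 'I_n -> R -> R :=
  fun j => if j == i then f else h j.

Variable I : finType.
Implicit Type h : I -> 'I_n -> R -> R.

Lemma set_coord_id x i : set_coord x i (x ord0 i) = x.
Proof. by apply/rowP => j; rewrite mxE; case: eqP => [->|]. Qed.

Lemma prod_set_factor (g : 'I_n -> R -> R) i f x :
  \prod_j set_factor g i f j (x ord0 j) =
  f (x ord0 i) * \prod_(j | j != i) g j (x ord0 j).
Proof.
rewrite (bigD1 i)//= {1}/set_factor eqxx; congr (_ * _).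
by apply: eq_bigr => j ji; rewrite /set_factor (negbTE ji).
Qed.

Lemma tensor_set_coord h x i t : tensor h (set_coord x i t) =
  \sum_k (\prod_(j | j != i) h k j (x ord0 j)) * h k i t.
Proof.
apply: eq_bigr => k _; rewrite (bigD1 i)//= mxE eqxx mulrC; congr (_ * _).
by apply: eq_bigr => j /negbTE ji; rewrite mxE ji.
Qed.

Lemma tensor_set_factor h (f : I -> R -> R) x i :
  tensor (fun k => set_factor (h k) i (f k)) x =
  \sum_k (\prod_(j | j != i) h k j (x ord0 j)) * f k (x ord0 i).
Proof. by apply: eq_bigr => k _; rewrite prod_set_factor mulrC. Qed.

Lemma continuous_tensor h : (forall k j, continuous (h k j)) ->
  continuous (tensor h).
Proof.
move=> ch; rewrite /tensor.
have cf k j : continuous (fun x => h k j (x ord0 j)).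
  move=> x; apply: (@continuous_comp _ _ _ (fun x => x ord0 j)).
    exact: coord_continuous.
  exact: ch.
have cp k (r : seq 'I_n) : continuous (fun x => \prod_(j <- r) h k j (x ord0 j)).
  elim: r => [|j r IH] x.
    under eq_fun do rewrite big_nil.
    exact: cst_continuous.
  under eq_fun do rewrite big_cons.
  by apply: continuousM; [exact: cf | exact: IH].
elim: (index_enum I) => [|k r IH] x.
  under eq_fun do rewrite big_nil.
  exact: cst_continuous.
under eq_fun do rewrite big_cons.
by apply: continuousD; [exact: cp | exact: IH].
Qed.

(** The difference quotients of [f] at [x] along the basis vector are those of the one-variable
    slice [g], as functions of the increment. *)
Lemma is_derive_coord (f : 'rV[R]_n -> R) (g : R -> R) x i d :
  (forall t, f (set_coord x i t) = g t) -> is_derive (x ord0 i) 1 g d ->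
  is_derive x (delta_mx ord0 i) f d.
Proof.
move=> fg [dg <-].
have e : (fun t : R => t^-1 *: ((f \o shift x) (t *: delta_mx ord0 i) - f x)) =
    (fun t : R => t^-1 *: ((g \o shift (x ord0 i)) (t *: 1) - g (x ord0 i))).
  apply/funext => t /=; rewrite -!fg set_coord_id; congr (_ *: (f _ - _)).
  apply/rowP => j; rewrite !mxE eqxx/=; case: eqP => [->|_].
    by rewrite /GRing.scale/=.
  by rewrite mulr0 add0r.
by apply: DeriveDef; rewrite /derivable /derive e.
Qed.

Lemma is_derive_tensor h (f : I -> R -> R) x i :
  (forall k t, is_derive t (1 : R) (h k i) (f k t)) ->
  is_derive x (delta_mx ord0 i) (tensor h)
    (tensor (fun k => set_factor (h k) i (f k)) x).
Proof.
move=> dh.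
apply: (is_derive_coord (g := fun t =>
  \sum_k (\prod_(j | j != i) h k j (x ord0 j)) * h k i t)).
  by move=> t; rewrite tensor_set_coord.
rewrite tensor_set_factor.
elim: (index_enum I) => [|k r IH].
  under eq_fun do rewrite big_nil.
  by rewrite big_nil; exact: is_derive_cst.
under eq_fun do rewrite big_cons.
rewrite big_cons; apply: is_deriveD.
Qed.

(** A partial derivative only changes factors, so every iterated derivative is again a tensor with
    smooth factors. *)
Lemma smooth_tensor h : (forall k j, smooth1 (h k j)) -> smooth (tensor h).
Proof.
move=> sh s /=.
have [h' sh' ->] : exists2 h' : I -> 'I_n -> R -> R, (forall k j, smooth1 (h' k j)) &
    foldr (@partial R n) (tensor h) s = tensor h'.
  elim: s => [|i s [h' sh' e]] /=; first by exists h.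
  exists (fun k => set_factor (h' k) i (derive1 (h' k i))).
    move=> k j; rewrite /set_factor; case: eqP => // _.
    exact: smooth1_derive.
  rewrite e; apply/funext => x; rewrite /partial.
  have d := @is_derive_tensor h' (fun k => derive1 (h' k i)) x i
    (fun k => smooth1_is_derive (sh' k i)).
  exact: derive_val.
split; first by apply: continuous_tensor => k j; exact: smooth1_continuous.
move=> i x; have d := @is_derive_tensor h' (fun k => derive1 (h' k i)) x i
    (fun k => smooth1_is_derive (sh' k i)).
exact: ex_derive.
Qed.

Lemma tensor_eq0 h (a b : 'I_n -> R) x : (forall k j, supp_in (a j) (b j) (h k j)) ->
  ~ (forall j, a j < x ord0 j < b j) -> tensor h x = 0.
Proof.
move=> sh /existsNP[j xj]; rewrite /tensor big1// => k _.
rewrite (bigD1 j)//= sh ?mul0r//.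
case: (leP (x ord0 j) (a j)) => [|ax]; [by left | right].
by rewrite leNgt; apply/negP => xb; apply: xj; rewrite ax.
Qed.

Lemma test_function_tensor h (a b : 'I_n -> R) (Omega : set 'rV[R]_n) :
  (forall k j, smooth1 (h k j)) -> (forall k j, supp_in (a j) (b j) (h k j)) ->
  [set x : 'rV[R]_n | forall j, a j <= x ord0 j <= b j] `<=` Omega ->
  test_function Omega (tensor h).
Proof.
move=> sh suph box.
have cK : compact [set x : 'rV[R]_n | forall j, `[a j, b j]%classic (x ord0 j)].
  by apply: (@rV_compact _ _ (fun j => `[a j, b j]%classic)) => j; exact: segment_compact.
have clK := compact_closed (@norm_hausdorff _ _) cK.
have KE : closure [set x | tensor h x != 0] `<=`
    [set x : 'rV[R]_n | forall j, `[a j, b j]%classic (x ord0 j)].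
  rewrite [X in _ `<=` X](closure_id _).1//; apply: closure_subset => x /= /eqP hx j.
  rewrite in_itv/=; apply/andP.
  have /contrapT H := contra_not (@tensor_eq0 h a b x suph) hx.
  by have /andP[/ltW ? /ltW ?] := H j.
split.
- exact: smooth_tensor.
- by apply: subclosed_compact KE => //; exact: closed_closure.
- move=> x /KE /= xK; apply: box => j /=.
  by have := xK j; rewrite in_itv.
Qed.

End tensors.

(** * Averages and primitives along one coordinate *)

Section averaging.
Context {R : realType} {n : nat} (I : finType).
Notation mu := (@lebesgue_measure R).
Variables (a b : 'I_n -> R) (w : 'I_n -> R -> R) (l C : R).
Hypotheses (ab : forall i, a i <= b i) (bal : forall i, b i - a i <= l).
Hypotheses (sw : forall i, smooth1 (w i)) (supw : forall i, supp_in (a i) (b i) (w i)).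
Hypotheses (w1 : forall i, \int[mu]_t w i t = 1) (wC : forall i t, `|w i t| <= C / l).
Hypothesis (l0 : 0 < l).
Implicit Types (i j : 'I_n) (x : 'rV[R]_n) (t M : R) (h : I -> 'I_n -> R -> R).

Definition mass (f : R -> R) : R := \int[mu]_t f t.

Definition box_smooth h :=
  forall k j, smooth1 (h k j) /\ supp_in (a j) (b j) (h k j).

Definition coord_average i h : I -> 'I_n -> R -> R :=
  fun k => set_factor (h k) i (fun t => mass (h k i) * w i t).

Definition coord_rest i (f : R -> R) t := f t - mass f * w i t.

Definition coord_primitive i h : I -> 'I_n -> R -> R :=
  fun k => set_factor (h k) i (primitive (coord_rest i (h k i))).

Lemma supp_in_itg i (f : R -> R) : smooth1 f -> supp_in (a i) (b i) f ->
  mu.-integrable setT (EFin \o f).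
Proof.
by move=> sf supf; apply: supp_in_integrable supf => //; exact: smooth1_continuous.
Qed.

Lemma mass_average i (c : R) : mass (fun t => c * w i t) = c.
Proof.
rewrite /mass RintegralZl//; first by rewrite w1 mulr1.
exact: supp_in_itg.
Qed.

Lemma smooth1_rest i f : smooth1 f -> smooth1 (coord_rest i f).
Proof.
move=> sf; apply: smooth1D => //.
have -> : (fun t => - (mass f * w i t)) = (fun t => - mass f * w i t).
  by apply/funext => t; rewrite mulNr.
exact: smooth1Z.
Qed.

Lemma supp_in_rest i f : supp_in (a i) (b i) f -> supp_in (a i) (b i) (coord_rest i f).
Proof. by move=> sf t tab; rewrite /coord_rest sf// supw// mulr0 subr0. Qed.

Lemma mass_rest i f : smooth1 f -> supp_in (a i) (b i) f -> mass (coord_rest i f) = 0.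
Proof.
move=> sf supf; rewrite /mass /coord_rest RintegralB//.
- by rewrite -/(mass f) -/(mass (fun t => mass f * w i t)) mass_average subrr.
- exact: supp_in_itg supf.
- apply: (@supp_in_itg i); first exact: smooth1Z.
  by move=> t tab; rewrite supw// mulr0.
Qed.

Lemma box_smooth_average i h : box_smooth h -> box_smooth (coord_average i h).
Proof.
move=> sh k j; rewrite /coord_average /set_factor; case: eqP => [->|_]; last exact: sh.
by split; [exact: smooth1Z | move=> t tab; rewrite supw// mulr0].
Qed.

Lemma box_smooth_primitive i h : box_smooth h -> box_smooth (coord_primitive i h).
Proof.
move=> sh k j; rewrite /coord_primitive /set_factor; case: eqP => [->|_]; last exact: sh.
have [s1 s2] := sh k i.
have s1' := smooth1_rest i s1; have s2' := supp_in_rest s2.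
split; first exact: smooth1_primitive_supp s2'.
by apply: supp_in_primitive => //; exact: mass_rest.
Qed.

Lemma is_derive_coord_primitive i h x : box_smooth h ->
  is_derive x (delta_mx ord0 i) (tensor (coord_primitive i h))
    (tensor h x - tensor (coord_average i h) x).
Proof.
move=> sh.
have -> : tensor h x - tensor (coord_average i h) x =
    tensor (fun k => set_factor (coord_primitive i h k) i (coord_rest i (h k i))) x.
  rewrite !tensor_set_factor -[in tensor h x](@set_coord_id _ _ x i) tensor_set_coord.
  rewrite -sumrB; apply: eq_bigr => k _; rewrite -mulrBr; congr (_ * _).
  by apply: eq_bigr => j /negbTE ji; rewrite /coord_primitive /set_factor ji.
apply: is_derive_tensor => k t; rewrite /coord_primitive {1}/set_factor eqxx.
have [s1 s2] := sh k i.
apply: (@is_derive_primitive _ (a i) (b i)); last exact: supp_in_rest.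
by apply: smooth1_continuous; exact: smooth1_rest.
Qed.

Lemma partial_coord_primitive i h x : box_smooth h ->
  tensor h x = tensor (coord_average i h) x + partial i (tensor (coord_primitive i h)) x.
Proof.
move=> sh; have d := is_derive_coord_primitive i x sh.
by rewrite /partial derive_val addrC subrK.
Qed.

(** Only the whole sum is bounded by [M], not its terms. The integral along coordinate i is
    therefore read as the increment of [P], whose derivative is the slice of [tensor h]; the length
    of the interval, at most l, cancels against the bound C / l on [w i]. *)
Lemma tensor_average_le i h M x : box_smooth h -> (forall x, `|tensor h x| <= M) ->
  `|tensor (coord_average i h) x| <= M * C.
Proof.
move=> sh hM.
pose c k := \prod_(j | j != i) h k j (x ord0 j).
pose P t := \sum_k c k * primitive (h k i) t.
have dP t : is_derive t (1 : R) P (tensor h (set_coord x i t)).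
  rewrite tensor_set_coord /P; elim: (index_enum I) => [|k r IH].
    under eq_fun do rewrite big_nil.
    by rewrite big_nil; exact: is_derive_cst.
  under eq_fun do rewrite big_cons.
  rewrite big_cons.
  have [s1 s2] := sh k i.
  have d := is_derive_primitive (smooth1_continuous s1) s2 t.
  exact: is_deriveD.
have := derive_le_abs_diff (ab i) dP (fun t => hM _).
have -> : P (a i) = 0.
  by rewrite /P big1// => k _; rewrite (primitive_left (sh k i).2)// mulr0.
have -> : P (b i) = \sum_k c k * mass (h k i).
  by apply: eq_bigr => k _; rewrite (primitive_right (sh k i).2).
rewrite subr0 => le1.
have -> : tensor (coord_average i h) x = (\sum_k c k * mass (h k i)) * w i (x ord0 i).
  by rewrite tensor_set_factor mulr_suml; apply: eq_bigr => k _; rewrite mulrA.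
have M0 : 0 <= M by rewrite (le_trans _ (hM x)).
rewrite normrM (le_trans (ler_pM _ _ le1 (wC i _)))//.
rewrite (@le_trans _ _ (M * l * (C / l)))//.
  rewrite ler_wpM2r ?(le_trans _ (wC i (a i)))//.
  by rewrite ler_wpM2l.
by rewrite -mulrA (mulrC l) -mulrA mulVf ?mulr1// gt_eqF.
Qed.

(** Outside the box the function is 0. Inside, it starts from 0 on the face x_i = a i and has slope
    at most M + M C over a length at most l. *)
Lemma tensor_primitive_le i h M x : box_smooth h -> (forall x, `|tensor h x| <= M) ->
  `|tensor (coord_primitive i h) x| <= M * (1 + C) * l.
Proof.
move=> sh hM.
have sp := box_smooth_primitive i sh.
have M0 : 0 <= M by rewrite (le_trans _ (hM x)).
have C0 : 0 <= C.
  by have := le_trans (normr_ge0 _) (wC i (a i)); rewrite pmulr_lge0// invr_gt0.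
have [[xa xb]|out] := pselect (a i < x ord0 i /\ x ord0 i < b i); last first.
  rewrite (@tensor_eq0 _ _ _ _ a b)//.
  - by rewrite normr0 !mulr_ge0 ?addr_ge0// ltW.
  - by move=> k j; exact: (sp k j).2.
  - by move=> /(_ i)/andP[? ?]; apply: out.
pose P t := tensor (coord_primitive i h) (set_coord x i t).
have dP t : is_derive t (1 : R) P (tensor h (set_coord x i t) -
    tensor (coord_average i h) (set_coord x i t)).
  (* The derivative in direction i at [set_coord x i t] is that of the slice [P] at t: the two
     difference quotients coincide. *)
  have [] := is_derive_coord_primitive i (set_coord x i t) sh.
  rewrite /derivable /derive.
  set q := (fun s : R => s^-1 *: _) => dq eq.
  have e : q = (fun s : R => s^-1 *: ((P \o shift t) (s *: 1) - P t)).
    apply/funext => s; rewrite /q /P /=; congr (_ *: (tensor _ _ - _)).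
    apply/rowP => j; rewrite !mxE eqxx/=; case: eqP => [_|_].
      by rewrite /GRing.scale/=.
    by rewrite mulr0 add0r.
  by apply: DeriveDef; rewrite /derivable /derive -e.
have dM t : `|tensor h (set_coord x i t) -
    tensor (coord_average i h) (set_coord x i t)| <= M * (1 + C).
  rewrite (le_trans (ler_normB _ _))// mulrDr mulr1 lerD//.
  exact: tensor_average_le.
have := derive_le_abs_diff (ltW xa) dP dM.
rewrite /P set_coord_id.
have -> : tensor (coord_primitive i h) (set_coord x i (a i)) = 0.
  apply: (@tensor_eq0 _ _ _ _ a b) => [k j|]; first exact: (sp k j).2.
  by move=> /(_ i); rewrite mxE eqxx ltxx.
rewrite subr0 => /le_trans; apply.
rewrite ler_wpM2l ?mulr_ge0 ?addr_ge0// (le_trans _ (bal i))//.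
by rewrite lerD2r ltW.
Qed.

End averaging.

(** * Approximation of indicator functions *)

Section approximable_sets.
Context d (T : measurableType d) (R : realType).
Variables (mu : {measure set T -> \bar R}) (P : set T) (w : T -> R).
Hypotheses (mP : measurable P) (iw : mu.-integrable P (EFin \o w)).
Hypothesis w0 : forall x, 0 <= w x.
Implicit Types (f g : T -> R) (A B : set T).

(** The weight will be 1 + |u|, so that closeness controls the integrals of f and of u f
    together. *)
Definition wdist f g : R := \int[mu]_(x in P) (w x * `|f x - g x|).

Lemma integrable_mul_bounded (u f : T -> R) (M : R) :
  mu.-integrable P (EFin \o u) -> measurable_fun P f ->
  (forall x, P x -> `|f x| <= M) -> mu.-integrable P (EFin \o (fun x => u x * f x)).
Proof.
move=> iu mf fM; have -> : EFin \o (fun x => u x * f x) = ((EFin \o u) \* (EFin \o f))%E.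
  by apply/funext => x; rewrite /= EFinM.
apply: integrableMl => //; exists M; split; first exact: num_real.
by move=> y My x Px /=; rewrite (le_trans (fM x Px))// ltW.
Qed.

Definition unit_fun f := measurable_fun P f /\ forall x, 0 <= f x <= 1.

Lemma unit_fun_indic A : measurable A -> unit_fun (\1_A).
Proof.
move=> mA; split; first exact: measurable_indic.
by move=> x; rewrite indicE; case: (_ \in _); rewrite ?lexx ?ler01.
Qed.

Lemma unit_fun_dist f g x : unit_fun f -> unit_fun g -> `|f x - g x| <= 1.
Proof.
move=> [_ /(_ x)/andP[f0 f1]] [_ /(_ x)/andP[g0 g1]].
by rewrite ler_norml; apply/andP; split; lra.
Qed.

Lemma integrable_wdist f g : unit_fun f -> unit_fun g ->
  mu.-integrable P (EFin \o (fun x => w x * `|f x - g x|)).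
Proof.
move=> uf ug; apply: (@integrable_mul_bounded _ _ 1) => //.
  apply: measurableT_comp => //; apply: measurable_funB; [exact: uf.1|exact: ug.1].
by move=> x _; rewrite normr_id unit_fun_dist.
Qed.

Lemma wdist_triangle f g k : unit_fun f -> unit_fun g -> unit_fun k ->
  wdist f k <= wdist f g + wdist g k.
Proof.
move=> uf ug uk; rewrite /wdist -RintegralD//; try exact: integrable_wdist.
apply: le_Rintegral => //; first exact: integrable_wdist.
  exact: integrableD (integrable_wdist uf ug) (integrable_wdist ug uk).
move=> x _; rewrite -mulrDr ler_wpM2l//.
by rewrite (le_trans _ (ler_normD _ _))// addrA subrK.
Qed.

Lemma wdist_cvg0 (f_ : nat -> T -> R) f : (forall n, unit_fun (f_ n)) -> unit_fun f ->
  (forall x, P x -> f_ n x @[n --> \oo] --> f x) ->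
  forall e, 0 < e -> exists n, wdist (f_ n) f <= e.
Proof.
move=> uf_ uf ff e e0.
have := @dominated_convergence _ _ _ mu _ mP
  (fun n x => (w x * `|f_ n x - f x|)%:E) (cst 0%E) (EFin \o w).
case.
- by move=> n; exact: measurable_int (integrable_wdist (uf_ n) uf).
- exact: measurable_cst.
- apply: aeW => x Px /=; apply: cvg_EFin; first by apply: nearW.
  rewrite -[X in _ --> X](mulr0 (w x)); apply: cvgMr.
  rewrite -[X in _ --> X](@normr0 _ R); apply: cvg_norm.
  by apply/subr_cvg0; exact: ff.
- exact: iw.
- apply: aeW => x n Px; rewrite /= lee_fin ger0_norm ?mulr_ge0//.
  by rewrite ler_piMr// unit_fun_dist.
move=> _ _; rewrite integral0 => cv.
have : \forall n \near \oo,
    (\int[mu]_(x in P) (w x * `|f_ n x - f x|)%:E < e%:E)%E.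
  move: cv => /fine_cvgP[fn cv].
  have := cv => /cvgr0Pnorm_lt/(_ e e0) H.
  near=> n.
  rewrite -[X in (X < _)%E]fineK; last by near: n; exact: fn.
  rewrite lte_fin (le_lt_trans (ler_norm _))//; near: n; exact: H.
move=> [n _ /(_ n (leqnn n)) H]; exists n.
by rewrite /wdist /Rintegral -lee_fin fineK ?ltW// integrable_fin_num// integrable_wdist.
Unshelve. all: by end_near. Qed.

Variable F : set (T -> R).
Hypothesis uF : forall f, F f -> unit_fun f.
Hypothesis F1 : F (cst 1).
Hypothesis FC : forall f, F f -> F (fun x => 1 - f x).
Hypothesis FM : forall f g, F f -> F g -> F (fun x => f x * g x).

(** Since 1 - f and f g on [F] mirror complement and intersection of sets, these sets form a
    sigma-algebra, and only a generating family has to be approximated by hand. *)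
Definition approximable A := measurable A /\
  forall e, 0 < e -> exists2 f, F f & wdist f \1_A <= e.

Lemma approximable_limit (f_ : nat -> T -> R) A : measurable A -> (forall n, F (f_ n)) ->
  (forall x, P x -> f_ n x @[n --> \oo] --> (\1_A x : R)) -> approximable A.
Proof.
move=> mA Ff cv; split=> // e e0.
have [n le] := wdist_cvg0 (fun n => uF (Ff n)) (unit_fun_indic mA) cv e0.
by exists (f_ n).
Qed.

Lemma approximableC A : approximable A -> approximable (~` A).
Proof.
move=> [mA aA]; split; first exact: measurableC.
move=> e e0; have [f Ff fe] := aA e e0; exists (fun x => 1 - f x); first exact: FC.
rewrite (le_trans _ fe)// /wdist le_eqVlt; apply/orP; left; apply/eqP.
apply: eq_Rintegral => x _; congr (_ * _).
rewrite !indicE in_setC -normrN; case: (x \in A) => /=; congr `|_|; ring.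
Qed.

Lemma approximableI A B : approximable A -> approximable B -> approximable (A `&` B).
Proof.
move=> [mA aA] [mB aB]; split; first exact: measurableI.
move=> e e0; have e20 : 0 < e / 2 by rewrite divr_gt0.
have [f Ff fe] := aA _ e20; have [g Fg ge] := aB _ e20.
exists (fun x => f x * g x); first exact: FM.
have uI := unit_fun_indic (measurableI _ _ mA mB).
have uA := unit_fun_indic mA; have uB := unit_fun_indic mB.
rewrite [leRHS](splitr e) (le_trans _ (lerD fe ge))//.
rewrite /wdist -RintegralD//; try by apply: integrable_wdist => //; exact: uF.
have ufg : unit_fun (fun x => f x * g x) by exact/uF/FM.
apply: le_Rintegral => //; first exact: integrable_wdist.
  exact: integrableD (integrable_wdist (uF Ff) uA) (integrable_wdist (uF Fg) uB).
move=> x _; rewrite -mulrDr ler_wpM2l//.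
have [_ /(_ x)/andP[g0 g1]] := uF Fg; have [_ /(_ x)/andP[A0 A1]] := uA.
rewrite indicI /=.
have -> : f x * g x - \1_A x * \1_B x =
    (f x - \1_A x) * g x + \1_A x * (g x - \1_B x) by ring.
rewrite (le_trans (ler_normD _ _))// !normrM lerD//.
  by rewrite ler_piMr// ger0_norm.
by rewrite ler_piMl// ger0_norm.
Qed.

Lemma approximable0 : approximable set0.
Proof.
split=> // e e0; exists (fun x => 1 - cst 1 x); first exact: FC.
rewrite /wdist (@eq_Rintegral _ _ _ mu _ (cst 0)).
  by rewrite /Rintegral integral0 ltW.
by move=> x _; rewrite indic0 /= !subrr normr0 mulr0.
Qed.

(** Finite unions come from complements and intersections. At each point their indicators are
    eventually constant, so dominated convergence brings one of them within e/2 of the countable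
    union. *)
Lemma approximable_bigcup (A : (set T)^nat) : (forall n, approximable (A n)) ->
  approximable (\bigcup_n A n).
Proof.
move=> aA; have mU : measurable (\bigcup_n A n).
  by apply: bigcupT_measurable => n; exact: (aA n).1.
pose B n := \big[setU/set0]_(k < n) A k.
have aB n : approximable (B n).
  elim: n => [|n IH]; first by rewrite /B big_ord0; exact: approximable0.
  rewrite /B big_ord_recr/= -/(B n) -[X in approximable X]setCK setCU.
  by apply: approximableC; apply: approximableI; exact: approximableC.
have uB n : unit_fun (\1_(B n)) by apply: unit_fun_indic; exact: (aB n).1.
have uU : unit_fun (\1_(\bigcup_n A n)) by exact: unit_fun_indic.
split=> // e e0; have e20 : 0 < e / 2 by rewrite divr_gt0.
have [|n Bn] := @wdist_cvg0 _ _ uB uU _ _ e20.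
  move=> x _; apply: cvg_near_cst; rewrite !indicE.
  have [[k _ Akx]|nA] := pselect ((\bigcup_n A n) x).
    have -> : x \in \bigcup_n A n by rewrite inE; exists k.
    near=> n; rewrite indicE mem_set// /B -bigcup_mkord; exists k => //=.
    by near: n; exact: nbhs_infty_gt.
  have -> : (x \in \bigcup_n A n) = false by apply: memNset.
  near=> n; rewrite indicE memNset// /B -bigcup_mkord => -[k _ Ak].
  by apply: nA; exists k.
have [f Ff fe] := (aB n).2 _ e20.
exists f => //; rewrite (le_trans (wdist_triangle (uF Ff) (uB n) uU))//.
by rewrite [leRHS](splitr e) lerD.
Unshelve. all: by end_near. Qed.

Lemma sigma_algebra_approximable : sigma_algebra setT approximable.
Proof.
split; first exact: approximable0.
- by move=> A aA; rewrite setTD; exact: approximableC.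
- exact: approximable_bigcup.
Qed.

End approximable_sets.

(** * Lebesgue measure on row vectors *)

Section lebesgue_rV_theory.
Context {R : realType}.
Notation leb := (@lebesgue_measure R).

Lemma borel_lebesgueS n (A : set 'rV[R]_n.+1) :
  borel_lebesgue R n.+1 A =
  pushforward (leb \x borel_lebesgue R n)%E (@rV_cons R n) A.
Proof. by []. Qed.

Lemma borel_measurable_lebesgue n (A : set 'rV[R]_n) :
  measurable A -> measurable (A : set (lebesgue_rV_type R n)).
Proof. by move=> mA; apply: sub_caratheodory; exact: sub_sigma_algebra. Qed.

Lemma lebesgue_rV_borel n (A : set 'rV[R]_n) :
  measurable A -> lebesgue_rV R n A = borel_lebesgue R n A.
Proof. by move=> mA; rewrite /lebesgue_rV/=; exact: measurable_mu_extE. Qed.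

Lemma measurable_fun_lebesgue n (D : set 'rV[R]_n) d (T : measurableType d)
    (f : 'rV[R]_n -> T) :
  measurable (D : set (lebesgue_rV_type R n)) ->
  measurable_fun setT f -> measurable_fun (D : set (lebesgue_rV_type R n)) f.
Proof.
move=> mD mf _ A mA; apply: measurableI => //.
by apply: borel_measurable_lebesgue; rewrite -[X in measurable X]setTI; exact: mf.
Qed.

Lemma measurable_box n (S : 'I_n -> set R) :
  (forall i, measurable (S i)) ->
  measurable [set x : 'rV[R]_n | forall i, S i (x ord0 i)].
Proof.
move=> mS.
have -> : [set x : 'rV[R]_n | forall i, S i (x ord0 i)] =
    \big[setI/setT]_(i <- enum 'I_n) ((fun x : 'rV[R]_n => x ord0 i) @^-1` S i).
  apply/seteqP; split=> x /=.
    by move=> Sx; rewrite -bigcap_seq => i _; exact: Sx.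
  by rewrite -bigcap_seq => Sx i; apply: (Sx i); rewrite /= mem_enum.
apply: bigsetI_measurable => i _; rewrite -[X in measurable X]setTI.
exact: measurable_coord.
Qed.

Lemma borel_lebesgue_box n (S : 'I_n -> set R) (s : 'I_n -> R) :
  (forall i, measurable (S i)) -> (forall i, leb (S i) = (s i)%:E) ->
  borel_lebesgue R n [set x : 'rV[R]_n | forall i, S i (x ord0 i)] =
  (\prod_i s i)%:E.
Proof.
elim: n S s => [|n IH] S s mS lS.
  rewrite big_ord0 /= diracE mem_set//= => -[].
  by [].
rewrite borel_lebesgueS /pushforward.
have -> : @rV_cons R n @^-1` [set x : 'rV[R]_n.+1 | forall i, S i (x ord0 i)] =
    S ord0 `*` [set x : 'rV[R]_n | forall i, S (lift ord0 i) (x ord0 i)].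
  apply/seteqP; split=> -[t x] /=.
    move=> Sx; split=> [|i].
      by have := Sx ord0; rewrite /rV_cons mxE unlift_none.
    by have := Sx (lift ord0 i); rewrite /rV_cons mxE liftK.
  move=> [S0 Sx] i; rewrite /rV_cons mxE; case: unliftP => [j ->|->] //=.
rewrite product_measure1E//; last exact: (measurable_box (fun i => mS (lift ord0 i))).
transitivity ((s ord0)%:E * (\prod_i s (lift ord0 i))%:E)%E; last first.
  by rewrite -EFinM big_ord_recl.
congr (_ * _)%E; [exact: lS |].
exact: (IH (fun i => S (lift ord0 i)) (fun i => s (lift ord0 i)) (fun i => mS _) (fun i => lS _)).
exact: (mS ord0).
Qed.

Definition tensor1 n (g : 'I_n -> R -> R) (x : 'rV[R]_n) : R :=
  \prod_j g j (x ord0 j).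

Lemma measurable_tensor1 n (g : 'I_n -> R -> R) :
  (forall j, measurable_fun setT (g j)) -> measurable_fun setT (tensor1 g).
Proof.
move=> mg; apply: measurable_prod => j _.
apply: (measurableT_comp (mg j)); exact: measurable_coord.
Qed.

Lemma tensor1_cons n (g : 'I_n.+1 -> R -> R) p :
  tensor1 g (rV_cons p) = g ord0 p.1 * tensor1 (fun j => g (lift ord0 j)) p.2.
Proof.
rewrite /tensor1 big_ord_recl /rV_cons mxE unlift_none/=; congr (_ * _).
by apply: eq_bigr => j _; rewrite mxE liftK.
Qed.

(** Fubini by induction on the dimension, the first coordinate being split off by [rV_cons].
    Integrability is part of the induction because the next application of Fubini asks for it. *)
Lemma integral_tensor1_borel n (g : 'I_n -> R -> R) :
  (forall j, leb.-integrable setT (EFin \o g j)) ->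
  (borel_lebesgue R n).-integrable setT (EFin \o tensor1 g) /\
  (\int[borel_lebesgue R n]_x (tensor1 g x)%:E = (\prod_j \int[leb]_t g j t)%:E)%E.
Proof.
elim: n g => [|n IH] g ig.
  have e : EFin \o tensor1 g = cst 1%:E.
    by apply/funext => x /=; rewrite /tensor1 big_ord0.
  rewrite big_ord0 e; split.
    apply/integrableP; split; first exact: measurable_cst.
    by rewrite integral_dirac//= diracT normr1 mul1e ltry.
  under eq_integral do rewrite -[EFin _]/((EFin \o tensor1 g) _) e.
  by rewrite integral_dirac//= diracT mul1e.
have mg j : measurable_fun setT (g j).
  by apply/measurable_EFinP; exact: measurable_int (ig j).
have := IH (fun j => g (lift ord0 j)) (fun j => ig _).
set G := tensor1 _ => -[iG eG].
have mG : measurable_fun setT G by exact: measurable_tensor1.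
pose f p := (g ord0 p.1 * G p.2)%:E.
have mf : measurable_fun setT f.
  apply/measurable_EFinP; apply: measurable_funM.
    exact: measurableT_comp (mg ord0) measurable_fst.
  exact: measurableT_comp mG measurable_snd.
have fE p : (EFin \o tensor1 g) (rV_cons p) = f p by rewrite /= tensor1_cons.
have if0 : (leb \x borel_lebesgue R n)%E.-integrable setT f.
  apply/integrable12ltyP => //.
  have -> : (fun x => \int[borel_lebesgue R n]_y `|f (x, y)|)%E =
      (fun x => `|(g ord0 x)%:E| * \int[borel_lebesgue R n]_y `|(G y)%:E|)%E.
    apply/funext => x; rewrite /f/=.
    under eq_integral do rewrite normrM EFinM.
    rewrite ge0_integralZl//.
    by apply/measurable_EFinP; exact: measurableT_comp.
  rewrite ge0_integralZr//.
  - rewrite lte_mul_pinfty ?integral_ge0//.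
      by apply: integrable_fin_num => //; exact: integrable_abse (ig ord0).
    by have /integrableP[] := iG.
  - by apply/measurable_EFinP; apply: measurableT_comp => //; exact: mg.
  - exact: integral_ge0.
have mT : measurable_fun setT (EFin \o tensor1 g : 'rV[R]_n.+1 -> \bar R).
  by apply/measurable_EFinP; exact: measurable_tensor1.
have ifT : (leb \x borel_lebesgue R n)%E.-integrable (@rV_cons R n @^-1` setT)
    ((EFin \o tensor1 g) \o @rV_cons R n).
  by rewrite preimage_setT; apply: eq_integrable if0 => // p _; rewrite -fE.
split.
  exact: (integrable_pushforward (@measurable_rV_cons R n) mT ifT measurableT).
transitivity (\int[pushforward (leb \x borel_lebesgue R n) (@rV_cons R n)]_x
  (EFin \o tensor1 g) x)%E.
  by [].
rewrite (integral_pushforward (@measurable_rV_cons R n) mT ifT measurableT).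
rewrite preimage_setT.
transitivity (\int[leb \x borel_lebesgue R n]_p f p)%E.
  by apply: eq_integral => p _; exact: fE.
rewrite -integral12_prod_meas1//.
have -> : (fun x => \int[borel_lebesgue R n]_y f (x, y))%E =
    (fun x => (\prod_j \int[leb]_t g (lift ord0 j) t)%:E * (g ord0 x)%:E)%E.
  apply/funext => x; rewrite -eG /f/= muleC.
  under eq_integral do rewrite EFinM.
  exact: integralZl.
rewrite integralZl//; last exact: ig.
rewrite big_ord_recl mulrC EFinM; congr (_ * _)%E.
by rewrite /Rintegral fineK//; apply: integrable_fin_num => //; exact: ig.
Qed.

End lebesgue_rV_theory.

(** * Approximation of Borel sets by smooth tensors *)

Section tensor_algebra.
Context {R : realType} {n : nat} (i0 : 'I_n).
Implicit Types (f g : 'rV[R]_n -> R).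

Definition unit_tensor f := (exists (I : finType) (h : I -> 'I_n -> R -> R),
  (forall k j, smooth1 (h k j)) /\ f = tensor h) /\ forall x, 0 <= f x <= 1.

Lemma measurable_tensor (I : finType) (h : I -> 'I_n -> R -> R) :
  (forall k j, smooth1 (h k j)) -> measurable_fun setT (tensor h).
Proof.
move=> sh; apply: measurable_sum => k.
apply: (@measurable_tensor1 _ _ (h k)) => j.
by apply: continuous_measurable_fun; apply: smooth1_continuous; exact: sh.
Qed.

Lemma unit_tensor_unit_fun (P : set (lebesgue_rV_type R n)) f :
  measurable P -> unit_tensor f -> unit_fun P f.
Proof.
move=> mP [[I [h [sh ->]]] h01]; split=> //.
by apply: measurable_fun_lebesgue => //; exact: measurable_tensor.
Qed.

Lemma unit_tensor1 : unit_tensor (cst 1).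
Proof.
split; last by move=> x /=; rewrite ler01 lexx.
exists unit, (fun _ _ => cst 1); split; first by move=> _ j; exact: smooth1_cst.
apply/funext => x; rewrite /tensor (big_pred1 tt); last by case.
by rewrite big1.
Qed.

(** The constant 1 becomes an additional summand, and the minus sign is absorbed by the factor at
    [i0]. *)
Lemma unit_tensorC f : unit_tensor f -> unit_tensor (fun x => 1 - f x).
Proof.
move=> [[I [h [sh fE]]] f01]; split; last first.
  by move=> x; have /andP[? ?] := f01 x; apply/andP; split; lra.
exists (I + unit)%type, (fun k => match k with
  | inl k => set_factor (h k) i0 (fun t => -1 * h k i0 t)
  | inr _ => fun=> cst 1 end); split.
  move=> [k|_] j; last exact: smooth1_cst.
  by rewrite /set_factor; case: eqP => // _; exact: smooth1Z.
apply/funext => x; rewrite [RHS]/tensor big_sumType/= [in RHS]addrC.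
rewrite (big_pred1 tt); last by case.
rewrite big1//; congr (_ + _); rewrite fE /tensor -sumrN.
apply: eq_bigr => k _; rewrite prod_set_factor (bigD1 i0)//=.
by rewrite -mulrA mulN1r.
Qed.

Lemma unit_tensorM f g : unit_tensor f -> unit_tensor g ->
  unit_tensor (fun x => f x * g x).
Proof.
move=> [[I [h [sh fE]]] f01] [[J [k [sk gE]]] g01]; split; last first.
  move=> x; have /andP[? ?] := f01 x; have /andP[? ?] := g01 x.
  by rewrite mulr_ge0//= mulr_ile1.
exists (I * J)%type, (fun p j t => h p.1 j t * k p.2 j t); split.
  by move=> [p q] j; exact: smooth1M.
apply/funext => x; rewrite fE gE /tensor big_distrlr/= pair_big/=.
by apply: eq_bigr => -[p q] _; rewrite big_split.
Qed.

Definition single_factor j (f : R -> R) : unit -> 'I_n -> R -> R :=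
  fun=> set_factor (fun=> cst 1) j f.

Lemma tensor_single j (f : R -> R) (x : 'rV[R]_n) : tensor (single_factor j f) x = f (x ord0 j).
Proof.
rewrite /tensor (big_pred1 tt); last by case.
by rewrite prod_set_factor big1 ?mulr1.
Qed.

Lemma unit_tensor_single j (f : R -> R) : smooth1 f -> (forall t, 0 <= f t <= 1) ->
  unit_tensor (fun x => f (x ord0 j)).
Proof.
move=> sf f01; split=> //; exists unit, (single_factor j f); split.
  move=> k i; rewrite /single_factor /set_factor; case: eqP => // _.
  exact: smooth1_cst.
by apply/funext => x; rewrite tensor_single.
Qed.

Lemma smooth_step_cvg (t : R) :
  smooth_step (m.+1%:R * t) @[m --> \oo] --> ((0 < t)%R%:R : R).
Proof.
have [t0|t0] := ltP 0 t; last first.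
  apply: cvg_near_cst; near=> m; rewrite smooth_step_left//.
  by rewrite pmulr_rle0.
apply: cvg_near_cst; near=> m; rewrite smooth_step_right//.
rewrite -ler_pdivrMr// div1r (@le_trans _ _ m%:R)//; last by rewrite ler_nat.
near: m; exact: nbhs_infty_ger.
Unshelve. all: by end_near. Qed.

Variables (P : set (lebesgue_rV_type R n)) (w : 'rV[R]_n -> R).
Hypotheses (mP : measurable P) (iw : (lebesgue_rV R n).-integrable P (EFin \o w)).
Hypothesis w0 : forall x, 0 <= w x.

(** By [sigma_algebra_approximable] it suffices to treat the half-spaces x_i > a, which generate the
    Borel sets; their indicators are pointwise limits of ever steeper smooth steps in one
    coordinate. *)
Lemma borel_approximable (A : set 'rV[R]_n) : measurable A ->
  approximable (lebesgue_rV R n) P w unit_tensor A.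
Proof.
pose aF := approximable (lebesgue_rV R n) P w unit_tensor.
have SA : sigma_algebra setT aF.
  apply: sigma_algebra_approximable => //.
  - by move=> f; exact: unit_tensor_unit_fun.
  - exact: unit_tensor1.
  - by move=> f; exact: unit_tensorC.
  - by move=> f g; exact: unit_tensorM.
suff : @measurable _ 'rV[R]_n `<=` aF by exact.
apply: smallest_sub => // B.
rewrite -bigcup_seq => -[i _ [C mC <-]]; rewrite setTI.
suff : (@ocitv R).-sigma.-measurable `<=`
    [set C | aF ((fun x : 'rV[R]_n => x ord0 i) @^-1` C)] by apply; exact: mC.
rewrite RGenOInfty.measurableE; apply: smallest_sub.
  have [S0 SC SU] := SA; split.
  - by rewrite /= preimage_set0.
  - by move=> D /= /SC; rewrite setTD preimage_setC setTD.
  - by move=> D /= SD; rewrite preimage_bigcup; exact: SU.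
move=> _ [a ->] /=.
apply: (@approximable_limit _ _ _ _ _ _ mP iw w0 _ _
  (fun m x => smooth_step (m.+1%:R * (x ord0 i - a)))).
- by move=> f; exact: unit_tensor_unit_fun.
- apply: borel_measurable_lebesgue; rewrite -[X in measurable X]setTI.
  exact: measurable_coord.
- move=> m; apply: (@unit_tensor_single i (fun t => smooth_step (m.+1%:R * (t - a)))).
    have -> : (fun t : R => smooth_step (m.+1%:R * (t - a))) =
        (fun t => smooth_step (m.+1%:R * t + - (m.+1%:R * a))).
      by apply/funext => t; rewrite mulrBr.
    by apply: smooth1_affine; exact: smooth1_step.
  by move=> t; exact: smooth_step_itv.
- move=> x _; rewrite indicE.
  suff -> : (x \in (fun x : 'rV[R]_n => x ord0 i) @^-1` `]a, +oo[%classic) = (0 < x ord0 i - a).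
    exact: smooth_step_cvg.
  by apply/idP/idP; rewrite inE/= in_itv/= andbT subr_gt0.
Qed.

End tensor_algebra.

(** * Lebesgue measurable sets and cutoffs near the faces of a cube *)

Section lebesgue_sets_in_cubes.
Context {R : realType} {n : nat}.
Notation mu := (lebesgue_rV R n).

(** The outer measure is an infimum over countable Borel covers. Intersecting covers that exceed the
    measure of [A] by less than 1/(k+1) gives a Borel set of the same measure, and finiteness allows
    subtraction. *)
Lemma borel_hull (A : set (lebesgue_rV_type R n)) : measurable A ->
  (mu A < +oo)%E ->
  exists B : set 'rV[R]_n, [/\ measurable B, A `<=` B & mu (B `\` A) = 0%E].
Proof.
move=> mA Aoo.
have Afin : mu A \is a fin_num by rewrite ge0_fin_numE.
have cover (k : nat) : exists F : (set 'rV[R]_n)^nat,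
    [/\ forall i, measurable (F i), A `<=` \bigcup_i F i &
      (\sum_(i <oo) borel_lebesgue R n (F i) < mu A + (k.+1%:R^-1)%:E)%E].
  have k0 : 0 < k.+1%:R^-1 :> R by rewrite invr_gt0.
  have [x [F [mF AF] <-] lt] := lb_ereal_inf_adherent k0 Afin.
  by exists F.
have [F HF] := choice cover.
pose U k := \bigcup_i F k i.
have mU k : measurable (U k) by apply: bigcupT_measurable => i; have [] := HF k.
exists (\bigcap_k U k); split.
- exact: bigcapT_measurable.
- by move=> x Ax k _; have [_ + _] := HF k; apply.
have mB : measurable (\bigcap_k U k) by exact: bigcapT_measurable.
have mB' := borel_measurable_lebesgue mB.
have AB : A `<=` \bigcap_k U k.
  by move=> x Ax k _; have [_ + _] := HF k; apply.
have le k : (mu (\bigcap_k U k) <= mu A + (k.+1%:R^-1)%:E)%E.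
  have [mF _ /ltW] := HF k; apply: le_trans.
  rewrite lebesgue_rV_borel//.
  apply: (@le_trans _ _ (borel_lebesgue R n (U k))).
    by apply: le_measure; rewrite ?inE//; exact: bigcap_inf.
  by apply: measure_sigma_subadditive => //; exact: mU.
have leBA : (mu (\bigcap_k U k) <= mu A)%E.
  (* With k the integer part of 1/e, the excess 1/(k+1) is below e. *)
  apply/lee_addgt0Pr => e e0; have := le (Num.truncn e^-1).
  move=> /le_trans; apply; rewrite leeD2l// lee_fin.
  by rewrite -[leRHS]invrK lef_pV2 ?posrE ?invr_gt0// ltW// truncnS_gt.
rewrite measureD//; last exact: le_lt_trans Aoo.
have -> : \bigcap_k U k `&` A = A by exact: setIidr.
rewrite -(subee Afin); congr (_ - _)%E.
by apply/eqP; rewrite eq_le leBA le_measure// inE.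
Qed.

Lemma tensor_scale_prod (I : finType) (h : I -> 'I_n -> R -> R) (psi : 'I_n -> R -> R) x :
  tensor (fun k j t => psi j t * h k j t) x = tensor1 psi x * tensor h x.
Proof.
by rewrite /tensor mulr_sumr; apply: eq_bigr => k _; rewrite big_split.
Qed.

Variables (x0 : 'rV[R]_n) (l : R).
Hypothesis l0 : 0 < l.

Let a j := x0 ord0 j - l / 2.
Let b j := x0 ord0 j + l / 2.

(** The slope (m+1) 4/l is the inverse of [margin m]: each factor is 0 up to distance [margin m]
    from its face and 1 from distance [2 * margin m] on. *)
Definition cutoff m j t : R :=
  smooth_step (m.+1%:R * (4 / l) * (t - a j) - 1) *
  smooth_step (m.+1%:R * (4 / l) * (b j - t) - 1).

Definition margin (m : nat) : R := l / 4 / m.+1%:R.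

Lemma smooth1_cutoff m j : smooth1 (cutoff m j).
Proof.
set c := m.+1%:R * (4 / l).
have -> : cutoff m j = (fun t => smooth_step (c * t + (- (c * a j) - 1)) *
    smooth_step (- c * t + (c * b j - 1))).
  by apply/funext => t; rewrite /cutoff -/c; congr (smooth_step _ * smooth_step _); ring.
by apply: smooth1M; apply: smooth1_affine; exact: smooth1_step.
Qed.

Lemma cutoff_itv m j t : 0 <= cutoff m j t <= 1.
Proof.
rewrite /cutoff; set s := smooth_step _; set s' := smooth_step _.
have /andP[? ?] : 0 <= s <= 1 by exact: smooth_step_itv.
have /andP[? ?] : 0 <= s' <= 1 by exact: smooth_step_itv.
by rewrite mulr_ge0//= mulr_ile1.
Qed.

Lemma supp_in_cutoff m j : supp_in (a j + margin m) (b j - margin m) (cutoff m j).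
Proof.
have c0 : 0 < m.+1%:R * (4 / l) by rewrite !mulr_gt0 ?invr_gt0.
have cm : m.+1%:R * (4 / l) * margin m = 1.
  by rewrite /margin; field; rewrite !gt_eqF// ltr_pwDl.
move=> t [ta|tb]; rewrite /cutoff.
- rewrite smooth_step_left ?mul0r// subr_le0 -[leRHS]cm ler_pM2l//; lra.
- rewrite [X in _ * X]smooth_step_left ?mulr0// subr_le0 -[leRHS]cm ler_pM2l//; lra.
Qed.

Lemma cutoff_eventually1 (x : 'rV[R]_n) : cube x0 l x ->
  \forall m \near \oo, tensor1 (cutoff m) x = 1.
Proof.
move=> Px.
have big (y : R) : 0 < y -> \forall m \near \oo,
    smooth_step (m.+1%:R * (4 / l) * y - 1) = 1.
  move=> y0; have cy : 0 < 4 / l * y by rewrite !mulr_gt0 ?invr_gt0.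
  near=> m; rewrite smooth_step_right// lerBrDr -mulrA -ler_pdivrMr//.
  rewrite (@le_trans _ _ m%:R)//; last by rewrite ler_nat.
  near: m; exact: nbhs_infty_ger.
have all : \forall m \near \oo, forall j, cutoff m j (x ord0 j) = 1.
  apply: filter_forall => j; have /andP[xa xb] := Px j.
  have H1 : 0 < x ord0 j - a j by rewrite subr_gt0.
  have H2 : 0 < b j - x ord0 j by rewrite subr_gt0.
  near=> m; rewrite /cutoff.
  have -> : smooth_step (m.+1%:R * (4 / l) * (x ord0 j - a j) - 1) = 1.
    by near: m; exact: big H1.
  have -> : smooth_step (m.+1%:R * (4 / l) * (b j - x ord0 j) - 1) = 1.
    by near: m; exact: big H2.
  by rewrite mulr1.
near=> m; rewrite /tensor1 big1// => j _.
by move: j; near: m; exact: all.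
Unshelve. all: by end_near. Qed.

Variable w : 'rV[R]_n -> R.
Let P : set (lebesgue_rV_type R n) := cube x0 l.
Hypotheses (mP : measurable P) (iw : mu.-integrable P (EFin \o w)).
Hypothesis w0 : forall x, 0 <= w x.

Lemma wdist_null (A B : set (lebesgue_rV_type R n)) : measurable A -> measurable B ->
  A `<=` B -> mu (B `\` A) = 0%E -> wdist mu P w \1_B \1_A = 0.
Proof.
move=> mA mB AB BA0.
have i1 := integrable_wdist mP iw (unit_fun_indic R P mB) (unit_fun_indic R P mA).
rewrite /wdist /Rintegral (@ae_eq_integral _ _ _ mu _ (cst 0%E)) ?integral0//.
  exact: measurable_int i1.
exists (B `\` A); split => //; first exact: measurableD.
move=> x /= H; apply: contrapT => nBA; apply: H => _.
suff -> : \1_B x = \1_A x :> R by rewrite subrr normr0 mulr0.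
rewrite !indicE; congr ((_ : bool)%:R); apply/idP/idP; rewrite !inE; last exact: AB.
by move=> Bx; apply: contrapT => Ax; apply: nBA.
Qed.

(** Passing from [A] to a Borel hull costs nothing, from the hull to a tensor e/2, and from the
    tensor to its product with a cutoff another e/2, by dominated convergence. The margin [m]
    depends on [e], so bounds applied to [h] have to be uniform in [m]. *)
Lemma unit_tensor_dense (i0 : 'I_n) (A : set (lebesgue_rV_type R n)) (e : R) :
  measurable A -> (mu A < +oo)%E -> 0 < e ->
  exists m : nat, exists (I : finType) (h : I -> 'I_n -> R -> R),
  [/\ box_smooth (fun j => a j + margin m) (fun j => b j - margin m) h,
      forall x, 0 <= tensor h x <= 1 & wdist mu P w (tensor h) \1_A <= e].
Proof.
move=> mA Aoo e0; have e20 : 0 < e / 2 by rewrite divr_gt0.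
have [B [mB AB BA0]] := borel_hull mA Aoo.
have [mB' /(_ _ e20)[f Ff fB]] := borel_approximable i0 mP iw w0 mB.
have uf := unit_tensor_unit_fun mP Ff.
have [[I [h [sh fE]]] f01] := Ff.
pose g m x := tensor1 (cutoff m) x * f x.
have gE m : g m = tensor (fun k j t => cutoff m j t * h k j t).
  by apply/funext => x; rewrite tensor_scale_prod /g fE.
have g01 m x : 0 <= g m x <= 1.
  have /andP[? ?] := f01 x.
  have c0 : 0 <= tensor1 (cutoff m) x.
    by apply: prodr_ge0 => j _; have /andP[] := cutoff_itv m j (x ord0 j).
  have c1 : tensor1 (cutoff m) x <= 1.
    by apply: prodr_ile1 => j _; exact: cutoff_itv.
  by rewrite mulr_ge0//= mulr_ile1.
have sg m k j : smooth1 (fun t => cutoff m j t * h k j t).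
  by apply: smooth1M => //; exact: smooth1_cutoff.
have ug m : unit_fun P (g m).
  split=> //; rewrite gE; apply: measurable_fun_lebesgue => //.
  by apply: measurable_tensor => k j; exact: sg.
have [x Px|m gm] := @wdist_cvg0 _ _ _ mu P w mP iw w0 g f ug uf _ _ e20.
  apply: cvg_near_cst; near=> m; rewrite /g.
  have -> : tensor1 (cutoff m) x = 1.
    by near: m; exact: cutoff_eventually1.
  by rewrite mul1r.
exists m, I, (fun k j t => cutoff m j t * h k j t); split.
- move=> k j; split; first exact: sg.
  by move=> t tab; rewrite supp_in_cutoff// mul0r.
- by move=> x; rewrite -gE.
rewrite -gE.
have uA := unit_fun_indic R P mA; have uB := unit_fun_indic R P mB'.
have t1 := wdist_triangle mP iw w0 (ug m) uf uA.
have t2 := wdist_triangle mP iw w0 uf uB uA.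
rewrite (wdist_null mA mB' AB BA0) addr0 in t2.
rewrite (le_trans t1)// [leRHS](splitr e) lerD// (le_trans t2)//.
Unshelve. all: by end_near. Qed.

End lebesgue_sets_in_cubes.

(** * Oscillation of Sobolev functions on a cube *)

Section lebesgue_integrals_of_tensors.
Context {R : realType} {n : nat}.
Notation mu := (lebesgue_rV R n).

Lemma measurable_lebesgue_id :
  measurable_fun setT (fun x : lebesgue_rV_type R n => x : 'rV[R]_n).
Proof. exact: measurable_fun_lebesgue. Qed.

(** The identity map pushes the completed measure forward to a measure that agrees with
    [borel_lebesgue] on Borel sets. *)
Lemma integral_lebesgue_borel (f : 'rV[R]_n -> \bar R) :
  (borel_lebesgue R n).-integrable setT f ->
  mu.-integrable setT f /\
  (\int[mu]_x f x = \int[borel_lebesgue R n]_x f x)%E.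
Proof.
move=> intf; have mf := measurable_int _ intf.
pose phi := fun x : lebesgue_rV_type R n => x : 'rV[R]_n.
have mphi : measurable_fun setT phi := measurable_lebesgue_id.
have E (g : 'rV[R]_n -> \bar R) :
    (\int[pushforward mu phi]_x g x = \int[borel_lebesgue R n]_x g x)%E.
  apply: eq_measure_integral => A mA _.
  exact: (lebesgue_rV_borel mA).
have imu : mu.-integrable setT f.
  apply/integrableP; split; first exact: measurable_fun_lebesgue.
  have := @ge0_integral_pushforward _ _ _ _ _ phi mphi mu setT (abse \o f) measurableT.
  rewrite E => <- //; first by have /integrableP[] := intf.
    exact: measurableT_comp.
  by move=> x _; exact: abse_ge0.
split=> //; rewrite -E (integral_pushforward mphi)//.
Qed.

Lemma integral_tensor (I : finType) (h : I -> 'I_n -> R -> R) (a b : 'I_n -> R)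
    (P : set (lebesgue_rV_type R n)) :
  box_smooth a b h -> (forall x : 'rV[R]_n, (forall j, a j < x ord0 j < b j) -> P x) ->
  \int[mu]_(x in P) tensor h x = \sum_k \prod_j mass (h k j).
Proof.
move=> sh boxP; rewrite Rintegral_mkcond.
have -> : (tensor h \_ P) = tensor h.
  apply/funext => x; rewrite patchE; case: ifPn => // /negP xP.
  rewrite (@tensor_eq0 _ _ _ _ a b)//; first by move=> k j; exact: (sh k j).2.
  by move=> H; apply: xP; rewrite inE; exact: boxP.
have H k := integral_lebesgue_borel (integral_tensor1_borel
  (fun j => supp_in_integrable measurableT (smooth1_continuous (sh k j).1) (sh k j).2)).1.
have H' k := (integral_tensor1_borel
  (fun j => supp_in_integrable measurableT (smooth1_continuous (sh k j).1) (sh k j).2)).2.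
have e : (fun x : 'rV[R]_n => (tensor h x)%:E) =
    (fun x => \sum_k (tensor1 (h k) x)%:E)%E.
  by apply/funext => x; rewrite sumEFin.
rewrite /Rintegral e integral_sum//; last by move=> k; exact: (H k).1.
under eq_bigr do rewrite (H _).2 H'.
by rewrite sumEFin.
Qed.

Lemma measurable_cube (x : 'rV[R]_n) (r : R) : measurable (cube x r).
Proof.
have -> : cube x r = [set y : 'rV[R]_n | forall i,
    `]x ord0 i - r / 2, x ord0 i + r / 2[%classic (y ord0 i)].
  by apply/seteqP; split=> y /= H i; have := H i; rewrite in_itv.
apply: (@measurable_box _ _ (fun i => `]x ord0 i - r / 2, x ord0 i + r / 2[%classic)).
by move=> i; exact: measurable_itv.
Qed.

Lemma lebesgue_cube (x : 'rV[R]_n) (r : R) : 0 < r -> mu (cube x r) = (r ^+ n)%:E.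
Proof.
move=> r0; rewrite lebesgue_rV_borel; last exact: measurable_cube.
have -> : cube x r = [set y : 'rV[R]_n | forall i,
    `]x ord0 i - r / 2, x ord0 i + r / 2[%classic (y ord0 i)].
  by apply/seteqP; split=> y /= H i; have := H i; rewrite in_itv.
rewrite (@borel_lebesgue_box _ _
  (fun i => `]x ord0 i - r / 2, x ord0 i + r / 2[%classic) (fun=> r)).
- by rewrite prodr_const card_ord.
- by move=> i; exact: measurable_itv.
- move=> i; rewrite lebesgue_measure_itv/= lte_fin ifT; last lra.
  by congr EFin; field.
Qed.

End lebesgue_integrals_of_tensors.

(** * Deviation of integrals over subsets from a weighted mean *)

Section oscillation.
Context {R : realType} {n : nat}.
Notation mu := (lebesgue_rV R n).
Variables (x0 : 'rV[R]_n) (l C : R) (l0 : 0 < l).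
Let P : set (lebesgue_rV_type R n) := cube x0 l.
Variables (u : 'rV[R]_n -> R) (g : 'I_n -> 'rV[R]_n -> R).
Hypothesis iu : mu.-integrable P (EFin \o u).
Hypothesis ig : forall i, mu.-integrable P (EFin \o g i).
Hypothesis wg : forall i phi, test_function (cube x0 l) phi ->
  \int[mu]_(x in P) (u x * partial i phi x) = - \int[mu]_(x in P) (g i x * phi x).
Let a j := x0 ord0 j - l / 2.
Let b j := x0 ord0 j + l / 2.
Variable w : 'I_n -> R -> R.
Hypothesis sw : forall i, smooth1 (w i).
Hypothesis supw : forall i, supp_in (a i + l / 4) (b i - l / 4) (w i).
Hypothesis w1 : forall i, mass (w i) = 1.
Hypothesis wC : forall i t, `|w i t| <= C / l.

Definition total_grad : R := \sum_i \int[mu]_(x in P) `|g i x|.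

Let mP : measurable P.
Proof. by apply: borel_measurable_lebesgue; exact: measurable_cube. Qed.

Let Poo : (mu P < +oo)%E.
Proof. by rewrite lebesgue_cube// ltry. Qed.

(** One averaging costs (1 + C) in units of M l times the total gradient, and multiplies the sup
    bound for the remaining ones by C. *)
Fixpoint osc_const (m : nat) : R :=
  if m is m'.+1 then (1 + C) + C * osc_const m' else 0.

Definition averages (I : finType) (s : seq 'I_n) (h : I -> 'I_n -> R -> R) :=
  foldl (fun h i => coord_average w i h) h s.

Section box.
Variables (m : nat).
Let th := margin l m.
Let a' j := a j + th.
Let b' j := b j - th.

Let th0 : 0 < th. Proof. by rewrite /th /margin !divr_gt0. Qed.

Let th4 : th <= l / 4.
Proof.
rewrite /th /margin ler_pdivrMr// ler_peMr ?ler1n//.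
by rewrite divr_ge0// ltW.
Qed.

Let ab j : a' j <= b' j.
Proof. rewrite /a' /b' /a /b; move: th4 (l0); lra. Qed.

Let bal j : b' j - a' j <= l.
Proof. rewrite /a' /b' /a /b; move: th0 (l0); lra. Qed.

(** The margin never exceeds l/4, the distance of the support of [w i] from the faces; the same
    bumps thus serve every [m]. *)
Let supw' i : supp_in (a' i) (b' i) (w i).
Proof.
move=> t tab; apply: supw; move: th4 tab; rewrite /a' /b' => ? [?|?];
  [left|right]; lra.
Qed.

Variables (I : finType).
Implicit Type h : I -> 'I_n -> R -> R.

Lemma test_function_box h : box_smooth a' b' h -> test_function (cube x0 l) (tensor h).
Proof.
move=> sh; apply: (@test_function_tensor _ _ _ _ a' b').
- by move=> k j; exact: (sh k j).1.
- by move=> k j; exact: (sh k j).2.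
- move=> x H j; have /andP[] := H j; rewrite /a' /b' /a /b; move: th0 => ? ? ?.
  by apply/andP; split; lra.
Qed.

Lemma measurable_fun_box h : box_smooth a' b' h -> measurable_fun P (tensor h).
Proof.
move=> sh; apply: measurable_fun_lebesgue => //.
by apply: measurable_tensor => k j; exact: (sh k j).1.
Qed.

Lemma averages_le s h M : 0 <= C -> box_smooth a' b' h ->
  (forall x, `|tensor h x| <= M) ->
  `|\int[mu]_(x in P) (u x * tensor h x) -
    \int[mu]_(x in P) (u x * tensor (averages s h) x)| <=
  osc_const (size s) * M * l * total_grad.
Proof.
move=> C0; elim: s h M => [|i s IH] h M sh hM.
  by rewrite /averages/= subrr normr0 !mul0r.
have M0 : 0 <= M by rewrite (le_trans _ (hM 0)).
have sa := box_smooth_average sw supw' i sh.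
have sp := box_smooth_primitive ab sw supw' w1 i sh.
have aM x := tensor_average_le ab bal wC l0 i x sh hM.
have pM x := tensor_primitive_le ab bal sw supw' w1 wC l0 i x sh hM.
have ia := integrable_mul_bounded mP iu (measurable_fun_box sa) (fun x _ => aM x).
have ip := integrable_mul_bounded mP (ig i) (measurable_fun_box sp) (fun x _ => pM x).
have ih := integrable_mul_bounded mP iu (measurable_fun_box sh) (fun x _ => hM x).
have pE x : partial i (tensor (coord_primitive w i h)) x =
    tensor h x - tensor (coord_average w i h) x.
  by rewrite (partial_coord_primitive sw supw' i x sh) addrC addKr.
(* Here the weak derivative acts: tested against the primitive along coordinate i, it converts the
   change caused by averaging into an integral of [g i]. *)
have split1 : \int[mu]_(x in P) (u x * tensor h x) -
    \int[mu]_(x in P) (u x * tensor (coord_average w i h) x) =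
    - \int[mu]_(x in P) (g i x * tensor (coord_primitive w i h) x).
  rewrite -wg; last exact: test_function_box.
  rewrite -RintegralB//; apply: eq_Rintegral => x _.
  by rewrite pE mulrBr.
have gi0 j : 0 <= \int[mu]_(x in P) `|g j x| by exact: Rintegral_ge0.
have step : `|\int[mu]_(x in P) (u x * tensor h x) -
    \int[mu]_(x in P) (u x * tensor (coord_average w i h) x)| <=
    M * (1 + C) * l * total_grad.
  rewrite split1 normrN (le_trans (le_normr_Rintegral _ ip))//.
  have ign := integrable_norm (ig i).
  apply: (@le_trans _ _ (\int[mu]_(x in P) (M * (1 + C) * l * `|g i x|))).
    apply: le_Rintegral => //.
    - exact: integrable_norm ip.
    - exact: (integrableZl mP (M * (1 + C) * l) ign).
    - by move=> x _; rewrite normrM mulrC ler_wpM2r.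
  rewrite RintegralZl// ler_wpM2l//.
    by rewrite !mulr_ge0 ?addr_ge0// ltW.
  by rewrite /total_grad (bigD1 i)//= lerDl sumr_ge0.
have := lerD step (IH _ _ sa aM).
rewrite /averages/=.
move=> /(le_trans (ler_normD _ _)); rewrite addrA subrK => /le_trans; apply.
by rewrite le_eqVlt; apply/orP; left; apply/eqP; ring.
Qed.

(** A coordinate occurring again in [s] changes nothing, since [w j] has mass 1. *)
Lemma averagesE s h k j : averages s h k j =
  if j \in s then (fun t => mass (h k j) * w j t) else h k j.
Proof.
elim: s h => [//|i s IH] h; rewrite /averages/= -/(averages s _) IH in_cons.
rewrite /coord_average /set_factor; case: eqVneq => [->|_] //=.
case: ifP => // _; rewrite (mass_average sw supw' w1)//.
Qed.

(** Once all coordinates are averaged, each summand is [tensor1 w] times its product of masses, and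
    these products add up to the integral of [tensor h]. *)
Lemma box_average_le h M : 0 <= C -> box_smooth a' b' h ->
  (forall x, `|tensor h x| <= M) ->
  `|\int[mu]_(x in P) (u x * tensor h x) -
    \int[mu]_(x in P) tensor h x * \int[mu]_(x in P) (u x * tensor1 w x)| <=
  osc_const n * M * l * total_grad.
Proof.
move=> C0 sh hM; have := averages_le (enum 'I_n) C0 sh hM.
rewrite size_enum_ord.
have -> : \int[mu]_(x in P) (u x * tensor (averages (enum 'I_n) h) x) =
   \int[mu]_(x in P) tensor h x * \int[mu]_(x in P) (u x * tensor1 w x); last by [].
rewrite (integral_tensor (P := P) sh); last first.
  move=> x H j; have /andP[] := H j; rewrite /a' /b' /a /b; move: th0 => ? ? ?.
  by apply/andP; split; lra.
rewrite -RintegralZl//; last first.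
  apply: (@integrable_mul_bounded _ _ _ mu P mP u (tensor1 w) ((C / l) ^+ n)) => //.
    apply: measurable_fun_lebesgue => //; apply: measurable_tensor1 => j.
    by apply: continuous_measurable_fun; apply: smooth1_continuous.
  move=> x _; rewrite /tensor1 normr_prod.
  rewrite -[n in X in _ <= X]card_ord -prodr_const ler_prod// => j _.
  by rewrite normr_ge0 wC.
apply: eq_Rintegral => x _; rewrite mulrCA; congr (_ * _).
rewrite /tensor mulr_suml; apply: eq_bigr => k _.
rewrite -big_split/=; apply: eq_bigr => j _.
by rewrite averagesE mem_enum.
Qed.

End box.

Lemma set_average_le (i0 : 'I_n) (A : set (lebesgue_rV_type R n)) : 0 <= C -> measurable A ->
  A `<=` P ->
  `|\int[mu]_(x in A) u x - fine (mu A) * \int[mu]_(x in P) (u x * tensor1 w x)| <=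
  osc_const n * l * total_grad.
Proof.
move=> C0 mA AP; set c := \int[mu]_(x in P) (u x * tensor1 w x).
pose W x := 1 + `|u x|.
have mu_fin : mu P \is a fin_num by rewrite ge0_fin_numE.
have icst : mu.-integrable P (EFin \o cst (1 : R)).
  apply: measurable_bounded_integrable => //.
  exists 1; split; first exact: num_real.
  by move=> y y1 x Px /=; rewrite normr1 ltW.
have iW : mu.-integrable P (EFin \o W).
  by have := integrableD mP icst (integrable_norm iu).
have W0 x : 0 <= W x by rewrite addr_ge0.
have Aoo : (mu A < +oo)%E by rewrite (le_lt_trans _ Poo)// le_measure ?inE.
apply/ler_addgt0Pr => e e0.
(* Replacing the tensor by the indicator changes the integral against [u] by at most d and the
   measure by at most d; the latter is multiplied by c, so the total is d + d |c| = e. *)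
pose d := e / (1 + `|c|).
have c1 : 0 < 1 + `|c| by rewrite ltr_pwDl.
have d0 : 0 < d by rewrite divr_gt0.
have [m [I [h [sh h01 dist]]]] := unit_tensor_dense l0 mP iW W0 i0 mA Aoo d0.
have hM x : `|tensor h x| <= 1.
  by have /andP[? ?] := h01 x; rewrite ger0_norm.
have := box_average_le C0 sh hM; rewrite -/c mulr1.
have mh := measurable_fun_box sh.
have uh : unit_fun P (tensor h) by [].
have uA := unit_fun_indic R P mA.
have iuh := integrable_mul_bounded mP iu mh (fun x _ => hM x).
have A1 x : P x -> `|\1_A x : R| <= 1.
  by move=> _; have [_ /(_ x)/andP[? ?]] := uA; rewrite ger0_norm.
have iuA := integrable_mul_bounded mP iu uA.1 A1.
have i1h := integrable_mul_bounded mP icst mh (fun x _ => hM x).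
have i1A := integrable_mul_bounded mP icst uA.1 A1.
have iwd := integrable_wdist mP iW uh uA.
have eu : \int[mu]_(x in A) u x = \int[mu]_(x in P) (u x * \1_A x).
  rewrite -[A in LHS](setIidr AP) Rintegral_mkcondr; apply: eq_Rintegral => x _.
  by rewrite patchE indicE; case: ifPn; rewrite ?mulr1 ?mulr0.
have e1 : fine (mu A) = \int[mu]_(x in P) (cst 1 x * \1_A x).
  rewrite -[LHS]mul1r -Rintegral_cst// -[A in LHS](setIidr AP) Rintegral_mkcondr.
  apply: eq_Rintegral => x _.
  by rewrite patchE indicE; case: ifPn; rewrite ?mulr1 ?mulr0.
have e1h : \int[mu]_(x in P) tensor h x = \int[mu]_(x in P) (cst 1 x * tensor h x).
  by apply: eq_Rintegral => x _; rewrite mul1r.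
have D1 : `|\int[mu]_(x in P) (u x * tensor h x) - \int[mu]_(x in A) u x| <= d.
  rewrite eu -RintegralB// (le_trans _ dist)//.
  have iB := integrableB mP iuh iuA.
  rewrite (le_trans (le_normr_Rintegral _ _))// /wdist.
  apply: le_Rintegral => //; first exact: integrable_norm iB.
  by move=> x _; rewrite -mulrBr normrM ler_wpM2r// /W lerDr.
have D2 : `|\int[mu]_(x in P) tensor h x - fine (mu A)| <= d.
  rewrite e1 e1h -RintegralB// (le_trans _ dist)//.
  have iB := integrableB mP i1h i1A.
  rewrite (le_trans (le_normr_Rintegral _ _))// /wdist.
  apply: le_Rintegral => //; first exact: integrable_norm iB.
  by move=> x _; rewrite -mulrBr normrM ler_wpM2r// /W normr1 lerDl.
move: D1 D2; set U := \int[mu]_(x in P) (u x * tensor h x).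
set UA := \int[mu]_(x in A) u x; set V := \int[mu]_(x in P) tensor h x.
set mA' := fine _ => D1 D2 D3.
have -> : UA - mA' * c = (U - V * c) + (- (U - UA) + (V - mA') * c) by ring.
rewrite (le_trans (ler_normD _ _))// lerD//.
rewrite (le_trans (ler_normD _ _))// normrN normrM.
have -> : e = d + d * `|c|.
  by rewrite -[X in X + _]mulr1 -mulrDr /d divfK// gt_eqF.
by rewrite lerD// ler_wpM2r.
Qed.

End oscillation.

(** * The isoperimetric inequality, and restriction to subcubes *)

Section level_sets.
Context {R : realType} {n : nat} (i0 : 'I_n).
Notation mu := (lebesgue_rV R n).

Lemma measurable_cube_lebesgue (x : 'rV[R]_n) (l : R) :
  measurable (cube x l : set (lebesgue_rV_type R n)).
Proof. by apply: borel_measurable_lebesgue; exact: measurable_cube. Qed.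

(** The bound for [A] controls |A| (c - av), the one for [B] controls |B| (av - d). Weighting them
    by |B| and |A| and adding eliminates the unknown mean [av]. *)
Lemma level_sets_le : exists2 K : R, 0 < K &
  forall (x : 'rV[R]_n) (l : R) (u : 'rV[R]_n -> R) (g : 'I_n -> 'rV[R]_n -> R)
    (A B : set (lebesgue_rV_type R n)) (c d : R), 0 < l ->
  mu.-integrable (cube x l) (EFin \o u) ->
  (forall i, mu.-integrable (cube x l) (EFin \o g i)) ->
  (forall i phi, test_function (cube x l) phi ->
    \int[mu]_(y in cube x l) (u y * partial i phi y) =
    - \int[mu]_(y in cube x l) (g i y * phi y)) ->
  measurable A -> measurable B -> A `<=` cube x l -> B `<=` cube x l ->
  (forall y, A y -> c <= u y) -> (forall y, B y -> u y <= d) ->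
  fine (mu A) * fine (mu B) * (c - d) <=
    (fine (mu A) + fine (mu B)) * (K * l * \sum_i \int[mu]_(y in cube x l) `|g i y|).
Proof.
have [C C0 bumps] := @unit_bump_exists R.
have K0 m : 0 <= osc_const C m.
  by elim: m => //= m IH; rewrite !addr_ge0 ?mulr_ge0// ltW.
(* The summand 1 secures strict positivity of the constant. *)
exists (1 + osc_const C n); first by rewrite ltr_pwDl.
move=> x l u g A B c d l0 iu ig wg mA mB AP BP uA uB.
have mP := measurable_cube_lebesgue x l.
have bumps' j := bumps (x ord0 j - l / 2) l l0.
have [w Hw] := choice bumps'.
have sw j : smooth1 (w j) by have [] := Hw j.
have supw j : supp_in (x ord0 j - l / 2 + l / 4) (x ord0 j + l / 2 - l / 4) (w j).
  have [_ H _ _] := Hw j; suff <- : x ord0 j - l / 2 + l = x ord0 j + l / 2 by [].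
  lra.
have w1 j : mass (w j) = 1 by have [] := Hw j.
have wC j t : `|w j t| <= C / l.
  by have [_ _ _ /(_ t)/andP[? ?]] := Hw j; rewrite ger0_norm.
have av := set_average_le l0 iu ig wg sw supw w1 wC i0 (ltW C0).
have {av} := (av A mA AP, av B mB BP).
set av := \int[mu]_(y in _) (u y * _) => -[avA avB].
have G0 : 0 <= total_grad x l g by apply: sumr_ge0 => i _; exact: Rintegral_ge0.
set E := (1 + osc_const C n) * l * _.
have EK : osc_const C n * l * total_grad x l g <= E.
  by rewrite /E /total_grad -!mulrA ler_wpM2r// ?lerDr// mulr_ge0// ltW.
have fin (S : set (lebesgue_rV_type R n)) : measurable S -> S `<=` cube x l -> (mu S < +oo)%E.
  move=> mS SP; apply: (@le_lt_trans _ _ (mu (cube x l))).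
    by apply: le_measure; rewrite ?inE.
  by rewrite lebesgue_cube// ltry.
have iS (S : set (lebesgue_rV_type R n)) : measurable S -> S `<=` cube x l ->
    mu.-integrable S (EFin \o u).
  by move=> mS SP; apply: integrableS iu.
have icst (S : set (lebesgue_rV_type R n)) (k : R) : measurable S -> S `<=` cube x l ->
    mu.-integrable S (EFin \o cst k).
  move=> mS SP; apply: measurable_bounded_integrable => //; first exact: fin.
  exists `|k|; split; first exact: num_real.
  by move=> y yk z _ /=; rewrite ltW.
have leA : fine (mu A) * (c - av) <= E.
  apply: le_trans EK; apply: le_trans avA; apply: le_trans (ler_norm _).
  rewrite mulrBr lerD2r mulrC -Rintegral_cst//.
  by apply: le_Rintegral => //; [exact: icst | exact: iS].
have leB : fine (mu B) * (av - d) <= E.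
  apply: le_trans EK; apply: le_trans avB; rewrite distrC; apply: le_trans (ler_norm _).
  rewrite mulrBr lerD2l lerN2 mulrC -Rintegral_cst//.
  by apply: le_Rintegral => //; [exact: iS | exact: icst].
have a0 : 0 <= fine (mu A) by rewrite fine_ge0.
have b0 : 0 <= fine (mu B) by rewrite fine_ge0.
have := lerD (ler_wpM2l b0 leA) (ler_wpM2l a0 leB).
rewrite /total_grad; move: (fine _) (fine _) => p q; nra.
Qed.

Lemma test_function_off (Omega : set 'rV[R]_n) phi x : test_function Omega phi ->
  ~ Omega x -> phi x = 0 /\ forall i, partial i phi x = 0.
Proof.
move=> [_ _ KO] Ox.
have xK : ~ closure [set x | phi x != 0] x by move/KO.
have : \forall y \near x, phi y = 0.
  have oK : open (~` closure [set x | phi x != 0]).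
    by apply: closed_openC; exact: closed_closure.
  have := open_nbhs_nbhs (conj oK xK : open_nbhs x _).
  apply: filterS => y yK; apply: contrapT => /eqP py; apply: yK.
  exact: subset_closure.
move=> nx; split; first exact: nbhs_singleton nx.
move=> i; rewrite /partial (near_eq_derive (g := cst 0))//.
exact: derive_cst.
Qed.

(** A test function of [P] is one of [Q]; it vanishes near every point off [P], together with its
    partial derivatives, so both integrals over [Q] reduce to [P]. *)
Lemma weak_partial_sub (P Q : set (lebesgue_rV_type R n)) i (u g : 'rV[R]_n -> R) phi :
  P `<=` Q -> weak_partial Q i u g -> test_function P phi ->
  \int[mu]_(y in P) (u y * partial i phi y) = - \int[mu]_(y in P) (g y * phi y).
Proof.
move=> PQ [_ _ wp] tP.
have tQ : test_function Q phi.
  by have [? ? KP] := tP; split=> //; exact: subset_trans KP PQ.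
have restrict (f : 'rV[R]_n -> R) : (forall x, ~ P x -> f x = 0) ->
    \int[mu]_(y in Q) f y = \int[mu]_(y in P) f y.
  move=> f0; rewrite -[P in RHS](setIidr PQ) Rintegral_mkcondr.
  apply: eq_Rintegral => x _; rewrite patchE; case: ifPn => // /negP xP.
  by apply: f0 => Px; apply: xP; rewrite inE.
have := wp _ tQ; rewrite !restrict// => x xP.
- by rewrite (test_function_off tP xP).1 mulr0.
- by rewrite (test_function_off tP xP).2 mulr0.
Qed.

(** A weak gradient is a priori integrable on compact subsets only. Measurability on the open cube
    follows from its exhaustion by the closed boxes [K m]. *)
Lemma locally_integrable_measurable (x : 'rV[R]_n) (r : R) (f : 'rV[R]_n -> R) :
  0 < r -> locally_integrable_rV (cube x r) f ->
  measurable_fun (cube x r : set (lebesgue_rV_type R n)) f.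
Proof.
move=> r0 lf.
pose lo m j := x ord0 j - r / 2 + margin r m.
pose hi m j := x ord0 j + r / 2 - margin r m.
pose K m : set 'rV[R]_n := [set y | forall j, `[lo m j, hi m j]%classic (y ord0 j)].
have mar m : 0 < margin r m by rewrite /margin !divr_gt0.
have KQ m : K m `<=` cube x r.
  move=> y Ky j; have := Ky j; rewrite /= in_itv/= /lo /hi => /andP[? ?].
  by have := mar m; move=> ?; apply/andP; split; lra.
have QE : cube x r = \bigcup_m K m.
  apply/seteqP; split=> [y Qy|y [m _ /KQ]//].
  have : \forall m \near \oo, forall j, `[lo m j, hi m j]%classic (y ord0 j).
    apply: filter_forall => j; have /andP[ya yb] := Qy j.
    pose e := Num.min (y ord0 j - (x ord0 j - r / 2)) (x ord0 j + r / 2 - y ord0 j).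
    have e0 : 0 < e by rewrite lt_min !subr_gt0 ya.
    near=> m.
    have : margin r m <= e.
      rewrite /margin ler_pdivrMr// -ler_pdivrMl// (@le_trans _ _ m%:R)//; last by rewrite ler_nat.
      near: m; exact: nbhs_infty_ger.
    rewrite le_min => /andP[? ?].
    by rewrite /= in_itv/= /lo /hi; apply/andP; split; lra.
  by move=> [m _ /(_ m (leqnn m)) Km]; exists m.
have mK m : measurable (K m : set (lebesgue_rV_type R n)).
  apply: borel_measurable_lebesgue.
  by apply: (@measurable_box _ _ (fun j => `[lo m j, hi m j]%classic)) => j; exact: measurable_itv.
rewrite QE; apply/measurable_fun_bigcup => // m.
apply/measurable_EFinP; apply: measurable_int; apply: lf (KQ m).
by apply: (@rV_compact _ _ (fun j => `[lo m j, hi m j]%classic)) => j; exact: segment_compact.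
Unshelve. all: by end_near. Qed.

End level_sets.

(** * From the p-norm of the gradient to an L^1 bound *)

Section gradient_bound.
Context {R : realType} {n : nat}.
Notation mu := (lebesgue_rV R n).

(** If y <= t the last term suffices; otherwise y = y^(1-p) y^p and 1 - p <= 0. Integrated, with a
    suitable t, this does the work of Hölder's inequality up to a factor 2. *)
Lemma le_powR_add (y t p : R) : 1 <= p -> 0 <= y -> 0 < t ->
  y <= t `^ (1 - p) * y `^ p + t.
Proof.
move=> p1 y0 t0.
have [yt|ty] := leP y t; first by rewrite ler_wpDl// mulr_ge0// powR_ge0.
have y1 : 0 < y := lt_trans t0 ty.
apply: ler_wpDr; first exact: ltW.
have -> : y `^ p = y * y `^ (p - 1).
  transitivity (y `^ (1 + (p - 1))); first by rewrite addrC subrK.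
  by rewrite (@powRD _ y 1) ?powRr1// (gt_eqF y1) implybT.
have -> : t `^ (1 - p) = (t `^ (p - 1))^-1 by rewrite -powRN opprB.
rewrite mulrCA ler_peMr// mulrC ler_pdivlMr ?powR_gt0// mul1r.
by apply: ge0_ler_powR; rewrite ?subr_ge0// ?nnegrE ltW.
Qed.

Lemma lebesgue_cube_fin (x : 'rV[R]_n) (r : R) : 0 < r -> (mu (cube x r) < +oo)%E.
Proof. by move=> r0; rewrite lebesgue_cube// ltry. Qed.

(** It serves twice: for [u] itself, to get integrability, and for the components of the gradient,
    with [F] the Euclidean norm, to get the quantitative bound. *)
Lemma integrable_powR (P : set (lebesgue_rV_type R n)) (f F : 'rV[R]_n -> R) (p t : R) :
  1 <= p -> 0 < t -> measurable P -> (mu P < +oo)%E ->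
  measurable_fun P f -> measurable_fun P F -> (forall x, `|f x| <= F x) ->
  (\int[mu]_(x in P) (F x `^ p)%:E < +oo)%E ->
  mu.-integrable P (EFin \o f) /\
  \int[mu]_(x in P) `|f x| <=
    t `^ (1 - p) * \int[mu]_(x in P) (F x `^ p) + t * fine (mu P).
Proof.
move=> p1 t0 mP Poo mf mF fF Foo.
have mFp : measurable_fun P (fun x => F x `^ p).
  exact: (measurableT_comp (measurable_powR p)).
have iFp : mu.-integrable P (EFin \o (fun x => F x `^ p)).
  apply/integrableP; split; first exact/measurable_EFinP.
  by under eq_integral do rewrite /= ger0_norm ?powR_ge0//.
have icst : mu.-integrable P (EFin \o cst t).
  apply: measurable_bounded_integrable => //.
  exists `|t|; split; first exact: num_real.
  by move=> y yk z _ /=; rewrite ltW.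
have iZ := integrableZl mP (t `^ (1 - p)) iFp.
have iD := integrableD mP iZ icst.
have le x : `|f x| <= t `^ (1 - p) * F x `^ p + t.
  by rewrite (le_trans (fF x))// le_powR_add// (le_trans _ (fF x)).
have i_f : mu.-integrable P (EFin \o f).
  apply: le_integrable iD => //; first exact/measurable_EFinP.
  by move=> x _ /=; rewrite lee_fin (le_trans (le x))// ler_norm.
split=> //.
rewrite -Rintegral_cst// -RintegralZl// -RintegralD//.
by apply: le_Rintegral => //; exact: integrable_norm.
Qed.

Lemma coord_le_euclidean_norm (v : 'rV[R]_n) i : `|v ord0 i| <= euclidean_norm v.
Proof.
rewrite /euclidean_norm -sqrtr_sqr ler_wsqrtr// (bigD1 i)//= lerDl.
by apply: sumr_ge0 => j _; exact: sqr_ge0.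
Qed.

Lemma weak_gradient_L1 (x0 : 'rV[R]_n) (r p gamma : R) (u : 'rV[R]_n -> R) :
  1 <= p -> 0 < r -> 0 < gamma -> sobolev (cube x0 r) p u ->
  (gradient_norm (cube x0 r) p u <= (gamma * r `^ ((n%:R - p) / p))%:E)%E ->
  exists G : 'rV[R]_n -> 'rV[R]_n, [/\ is_weak_gradient (cube x0 r) u G,
    forall i, mu.-integrable (cube x0 r) (EFin \o (fun x => G x ord0 i)) &
    forall i, \int[mu]_(x in cube x0 r) `|G x ord0 i| <= 2 * gamma * r ^+ n / r].
Proof.
move=> p1 r0 gm0 [_ [G1 wG1 _]] gn.
have p0 : 0 < p := lt_le_trans ltr01 p1.
have pn0 : p != 0 by rewrite gt_eqF.
have mP := measurable_cube_lebesgue x0 r.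
(* The norm hypothesis speaks of the gradient picked by [weak_gradient]; [G1] guarantees that the
   pick is a weak gradient and not the default 0. *)
set G := weak_gradient (cube x0 r) u.
have wG : is_weak_gradient (cube x0 r) u G by apply: xgetPex; exists G1.
have mG i : measurable_fun (cube x0 r : set (lebesgue_rV_type R n)) (fun x => G x ord0 i).
  by apply: locally_integrable_measurable => //; have [] := wG i.
pose F x := euclidean_norm (G x).
have mF : measurable_fun (cube x0 r : set (lebesgue_rV_type R n)) F.
  have ms : measurable_fun setT (@Num.sqrt R).
    by apply: continuous_measurable_fun; exact: sqrt_continuous.
  apply: (measurableT_comp ms); apply: measurable_sum => i.
  exact: measurable_funX.
set E := gamma * _ in gn.
have E0 : 0 <= E by rewrite mulr_ge0 ?powR_ge0// ltW.
have FE : (\int[mu]_(x in cube x0 r) (F x `^ p)%:E <= (E `^ p)%:E)%E.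
  have Fge0 : (0 <= \int[mu]_(x in cube x0 r) (F x `^ p)%:E)%E.
    by apply: integral_ge0 => x _; rewrite lee_fin powR_ge0.
  rewrite -[leLHS]poweRe1// -(mulVf pn0) poweRrM -poweR_EFin.
  apply: gt0_ler_poweR; rewrite ?(ltW p0)//.
  - by rewrite in_itv/= poweR_ge0 leey.
  - by rewrite in_itv/= lee_fin E0 leey.
have Foo := le_lt_trans FE (ltry _).
(* This t makes both terms of the bound in [integrable_powR] equal. *)
pose t := gamma / r.
have t0 : 0 < t by rewrite divr_gt0.
exists G.
have bnd i := @integrable_powR (cube x0 r) (fun x => G x ord0 i) F p t p1 t0 mP
  (lebesgue_cube_fin x0 r0) (mG i) mF (fun x => coord_le_euclidean_norm (G x) i) Foo.
split=> // i; first exact: (bnd i).1.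
rewrite (le_trans (bnd i).2)// lebesgue_cube//=.
have Fp : \int[mu]_(x in cube x0 r) (F x `^ p) <= E `^ p.
  rewrite /Rintegral -lee_fin fineK//.
  by rewrite ge0_fin_numE// integral_ge0// => x _; rewrite lee_fin powR_ge0.
(* The exponents of gamma add up to (1 - p) + p = 1, those of r to (p - 1) + (n - p) = n - 1. *)
have EE : t `^ (1 - p) * E `^ p = gamma * r ^+ n / r.
  rewrite /E powRM ?powR_ge0 ?(ltW gm0)// -powRrM divfK ?gt_eqF//.
  rewrite /t powRM ?invr_ge0 ?(ltW gm0) ?(ltW r0)//.
  rewrite -(powR_inv1 (ltW r0)) -powRrM mulrACA.
  rewrite -!powRD ?(gt_eqF r0) ?(gt_eqF gm0) ?implybT// subrK powRr1 ?ltW//.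
  have -> : -1 * (1 - p) + (n%:R - p) = n%:R + -1 by ring.
  by rewrite powRD ?(gt_eqF r0) ?implybT// powR_mulrn ?ltW// mulrA.
rewrite (@le_trans _ _ (t `^ (1 - p) * E `^ p + t * r ^+ n))//.
  by rewrite lerD2r ler_wpM2l// powR_ge0.
by rewrite EE /t le_eqVlt; apply/orP; left; apply/eqP; field; rewrite gt_eqF.
Qed.

End gradient_bound.

(** * Grids of subcubes *)

Section grid.
Context {R : realType} {n : nat}.
Notation mu := (lebesgue_rV R n).
Variables (x0 : 'rV[R]_n) (r : R) (m : nat).
Hypothesis r0 : 0 < r.

Definition mesh : R := r / m.+1%:R.

Definition grid_point (j : 'I_n) (i : nat) : R := x0 ord0 j - r / 2 + i%:R * mesh.

Definition cell_center (k : {ffun 'I_n -> 'I_m.+1}) : 'rV[R]_n :=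
  \row_j (grid_point j (k j) + mesh / 2).

Definition cell k : set (lebesgue_rV_type R n) := cube (cell_center k) mesh.

Lemma mesh_gt0 : 0 < mesh. Proof. by rewrite divr_gt0. Qed.

Lemma cellP k (y : 'rV[R]_n) : cell k y <->
  forall j, grid_point j (k j) < y ord0 j < grid_point j (k j).+1.
Proof.
have e j : cell_center k ord0 j - mesh / 2 = grid_point j (k j).
  by rewrite mxE addrK.
have e' j : cell_center k ord0 j + mesh / 2 = grid_point j (k j).+1.
  by rewrite mxE /grid_point -natr1; field.
by split=> H j; have := H j; rewrite e e'.
Qed.

Lemma grid_point_le j (i : nat) : (i <= m.+1)%N -> grid_point j i <= x0 ord0 j + r / 2.
Proof.
move=> im; apply: (@le_trans _ _ (x0 ord0 j - r / 2 + r)); last lra.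
by rewrite /grid_point lerD2l /mesh mulrCA ler_piMr ?(ltW r0)// ler_pdivrMr// mul1r ler_nat.
Qed.

Lemma grid_point_ge j (i : nat) : x0 ord0 j - r / 2 <= grid_point j i.
Proof. by rewrite lerDl mulr_ge0// ltW// mesh_gt0. Qed.

Lemma cell_sub k : cell k `<=` cube x0 r.
Proof.
move=> y /cellP yk j; have /andP[y1 y2] := yk j.
rewrite (le_lt_trans (grid_point_ge j (k j)) y1)/=.
by rewrite (lt_le_trans y2)// grid_point_le.
Qed.

Lemma cell_center_in k : cube x0 r (cell_center k).
Proof.
apply: (@cell_sub k) => j; have := mesh_gt0 => ?.
by apply/andP; split; lra.
Qed.

Lemma trivIset_cell (D : set {ffun 'I_n -> 'I_m.+1}) : trivIset D cell.
Proof.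
move=> k k' _ _ [y [/cellP yk /cellP yk']]; apply/ffunP => j; apply/val_inj => /=.
have step (p q : nat) : grid_point j p < grid_point j q.+1 -> (p <= q)%N.
  by rewrite /grid_point ltrD2l ltr_pM2r ?mesh_gt0// ltr_nat.
have /andP[a b] := yk j; have /andP[a' b'] := yk' j.
by apply/eqP; rewrite eqn_leq !step// ?(lt_trans a b')// (lt_trans a' b).
Qed.

Lemma measurable_cell k : measurable (cell k).
Proof. exact: measurable_cube_lebesgue. Qed.

Lemma measure_bigsetU_le (I : Type) (s : seq I) (F : I -> set (lebesgue_rV_type R n)) :
  (forall i, measurable (F i)) ->
  (mu (\big[setU/set0]_(i <- s) F i) <= \sum_(i <- s) mu (F i))%E.
Proof.
move=> mF; elim: s => [|i s IH]; first by rewrite !big_nil measure0.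
rewrite !big_cons (le_trans (measureU2 _ _ _))//.
  by apply: bigsetU_measurable => j _; exact: mF.
by rewrite leeD2l.
Qed.

(** The cells are open and miss their walls. A wall is encoded as a box with one factor reduced to a
    point, so the product formula shows that it is null. *)
Definition grid_slice_factor (p : 'I_n * 'I_m.+1) (j : 'I_n) : set R :=
  if j == p.1 then [set grid_point p.1 p.2]
  else `]x0 ord0 j - r / 2, x0 ord0 j + r / 2[%classic.

Definition grid_slice (p : 'I_n * 'I_m.+1) : set (lebesgue_rV_type R n) :=
  [set y : 'rV[R]_n | forall j, grid_slice_factor p j (y ord0 j)].

Lemma measurable_grid_slice_factor p j : measurable (grid_slice_factor p j).
Proof.
by rewrite /grid_slice_factor; case: ifP => _; [exact: measurable_set1 | exact: measurable_itv].
Qed.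

Lemma measurable_grid_slice p : measurable (grid_slice p).
Proof.
apply: borel_measurable_lebesgue.
exact: (measurable_box (measurable_grid_slice_factor p)).
Qed.

Lemma grid_slice_null p : mu (grid_slice p) = 0%E.
Proof.
have mf := measurable_grid_slice_factor p.
rewrite lebesgue_rV_borel; last exact: measurable_box.
rewrite (@borel_lebesgue_box _ _ _ (fun j => if j == p.1 then 0 else r) mf).
  by rewrite (bigD1 p.1)//= eqxx mul0r.
move=> j; rewrite /grid_slice_factor; case: ifP => _.
  by rewrite lebesgue_measure_set1.
rewrite lebesgue_measure_itv/= lte_fin ifT; last by move: r0; lra.
by congr EFin; field.
Qed.

(** The index of the cell is the integer part of the rescaled coordinates. The lower inequality may
    be an equality in some coordinate, and then the point lies on a wall. *)
Lemma cube_sub_cells : cube x0 r `<=`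
  (\big[setU/set0]_k cell k) `|` \big[setU/set0]_p grid_slice p.
Proof.
move=> y Qy; pose t j := (y ord0 j - (x0 ord0 j - r / 2)) / mesh.
have t0 j : 0 <= t j.
  by have /andP[? _] := Qy j; rewrite divr_ge0 ?(ltW mesh_gt0)// subr_ge0 ltW.
have tm j : (Num.truncn (t j) < m.+1)%N.
  rewrite truncn_lt_nat// /t ltr_pdivrMr ?mesh_gt0// /mesh [ltRHS]mulrC divfK ?gt_eqF//.
  by have /andP[_ ?] := Qy j; lra.
pose k : {ffun 'I_n -> 'I_m.+1} := [ffun j => Ordinal (tm j)].
have yt j : y ord0 j = x0 ord0 j - r / 2 + t j * mesh.
  by rewrite /t divfK ?gt_eqF ?mesh_gt0// addrC subrK.
have lo j : grid_point j (k j) <= y ord0 j.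
  rewrite yt /grid_point lerD2l ler_pM2r ?mesh_gt0// ffunE /=.
  by have /andP[] := truncn_itv (t0 j).
have hi j : y ord0 j < grid_point j (k j).+1.
  rewrite yt /grid_point ltrD2l ltr_pM2r ?mesh_gt0// ffunE /=.
  by have /andP[] := truncn_itv (t0 j).
have [H|/existsNP[j yj]] := pselect (forall j, y ord0 j <> grid_point j (k j)).
  left; rewrite -bigcup_seq; exists k; first by rewrite /= mem_index_enum.
  by apply/cellP => j; rewrite hi andbT lt_neqAle lo andbT eq_sym; apply/eqP.
right; rewrite -bigcup_seq; exists (j, k j); first by rewrite /= mem_index_enum.
move=> i; rewrite /grid_slice_factor; case: eqP => [->|_].
  by rewrite /=; apply: contrapT.
by rewrite /= in_itv; exact: Qy.
Qed.

Lemma measure_le_cells (A : set (lebesgue_rV_type R n)) :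
  measurable A -> A `<=` cube x0 r ->
  (mu A <= \sum_k mu (A `&` cell k))%E.
Proof.
move=> mA AQ.
have mA' k : measurable (A `&` cell k).
  by apply: measurableI => //; exact: measurable_cell.
have mU : measurable (\big[setU/set0]_k (A `&` cell k)).
  by apply: bigsetU_measurable => k _; exact: mA'.
have mUS : measurable (\big[setU/set0]_p grid_slice p).
  by apply: bigsetU_measurable => p _; exact: measurable_grid_slice.
have le1 : (mu A <= mu ((\big[setU/set0]_k (A `&` cell k)) `|`
    \big[setU/set0]_p grid_slice p))%E.
  apply: le_measure; rewrite ?inE//; first exact: measurableU.
  move=> y Ay; have [|Sy] := cube_sub_cells (AQ y Ay); last by right.
  by rewrite -bigcup_seq => -[k ke ky]; left; rewrite -bigcup_seq; exists k.
apply: (le_trans le1); apply: (le_trans (measureU2 _ mU mUS)).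
rewrite -[leRHS]adde0; apply: leeD; first exact: measure_bigsetU_le.
apply: (le_trans (measure_bigsetU_le _ measurable_grid_slice)).
by rewrite big1// => p _; exact: grid_slice_null.
Qed.

Lemma sum_cells_integral (f : 'rV[R]_n -> R) :
  mu.-integrable (cube x0 r) (EFin \o f) ->
  \sum_k \int[mu]_(x in cell k) `|f x| <= \int[mu]_(x in cube x0 r) `|f x|.
Proof.
move=> i_f; have mQ := measurable_cube_lebesgue x0 r.
have ign := integrable_norm i_f.
have mf := measurable_int _ ign.
set U := \big[setU/set0]_(k : {ffun 'I_n -> 'I_m.+1}) cell k.
have mU : measurable U by apply: bigsetU_measurable => k _; exact: measurable_cell.
have UQ : U `<=` cube x0 r.
  by move=> y; rewrite /U -bigcup_seq => -[k _]; exact: cell_sub.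
have cQ k : mu.-integrable (cell k) (EFin \o (fun x => `|f x|)).
  by apply: integrableS ign => //; [exact: measurable_cell | exact: cell_sub].
rewrite -lee_fin -sumEFin.
under eq_bigr => k _ do rewrite /Rintegral fineK ?(integrable_fin_num (measurable_cell k) (cQ k))//.
rewrite -(@ge0_integral_bigsetU _ _ _ mu _ cell (fun x => `|f x|%:E))//.
- rewrite /Rintegral fineK ?(integrable_fin_num mQ ign)//.
  by apply: ge0_subset_integral.
- exact: measurable_cell.
- exact: index_enum_uniq.
- exact: trivIset_cell.
- exact: measurable_funS mf.
Qed.

End grid.

(** * Choice of the grid size and contradiction *)

Theorem corollary3p1 (R : realType) (N : nat) (p : R) (x0 : 'rV[R]_N)
    (r c alpha gamma' delta lambda : R) :
  (2 <= N)%N -> 1 <= p -> 0 < r -> 0 < c -> 0 < alpha < 1 -> 0 < gamma' ->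
  0 < delta < 1 -> 0 < lambda < 1 ->
  exists2 eta : R, 0 < eta < 1 &
    forall u : 'rV[R]_N -> R,
      sobolev (cube x0 r) p u ->
      ((alpha * r ^+ N)%:E <
        lebesgue_rV R N [set x | cube x0 r x /\ (c < u x)%R])%E ->
      (gradient_norm (cube x0 r) p u <=
        (gamma' * c * r `^ ((N%:R - p) / p))%:E)%E ->
      exists2 x1 : 'rV[R]_N, cube x0 r x1 &
        (((1 - delta) * (eta * r) ^+ N)%:E <
          lebesgue_rV R N [set x | [/\ cube x1 (eta * r) x, cube x0 r x &
                                      (lambda * c < u x)%R]])%E.
Proof.
move=> N2 p1 r0 c0 /andP[al0 al1] ga0 /andP[de0 de1] /andP[la0 la1].
have i0 : 'I_N by apply: (@Ordinal N 0); exact: ltnW.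
have [K K0 levels] := @level_sets_le R N i0.
(* If every cell fails, summation gives alpha r^N delta (1 - lambda) c < K (r/(m+1)) N (2 gamma' c
   r^N / r), which says exactly that m + 1 < T. *)
pose D := delta * (1 - lambda) * alpha.
have D0 : 0 < D by rewrite !mulr_gt0 ?subr_gt0.
pose T := 2 * K * N%:R * gamma' / D.
(* The additional successor makes m positive, so that eta = 1/(m+1) is strictly below 1 even for
   small T. *)
pose m := (Num.truncn T).+1.
have mT : T < m.+1%:R.
  by rewrite (lt_trans (truncnS_gt T))// ltr_nat.
have meshE : m.+1%:R^-1 * r = mesh r m by rewrite mulrC.
have l0 := mesh_gt0 m r0.
exists m.+1%:R^-1.
  by rewrite invr_gt0 ltr0n/= invf_lt1 ?ltr1n.
move=> u su hA hG; rewrite meshE.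
apply: contrapT => none.
have [G [wG iG boundG]] := weak_gradient_L1 p1 r0 (mulr_gt0 ga0 c0) su hG.
have mQ := measurable_cube_lebesgue x0 r.
have [[mu_u u_p] _] := su.
have iu : (lebesgue_rV R N).-integrable (cube x0 r) (EFin \o u).
  have [] // := integrable_powR p1 ltr01 mQ (lebesgue_cube_fin x0 r0) mu_u
    (measurableT_comp (@normr_measurable R setT) mu_u) (fun x => lexx `|u x|) u_p.
pose A := [set x | cube x0 r x /\ c < u x] : set (lebesgue_rV_type R N).
pose Ak (k : {ffun 'I_N -> 'I_m.+1}) := A `&` cell x0 r k.
pose Bk (k : {ffun 'I_N -> 'I_m.+1}) :=
  cell x0 r k `&` [set x | cube x0 r x /\ u x <= lambda * c].
pose Ck (k : {ffun 'I_N -> 'I_m.+1}) :=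
  cell x0 r k `&` [set x | cube x0 r x /\ lambda * c < u x].
have mlev (I : interval R) :
    measurable ([set x | cube x0 r x /\ u x \in I] : set (lebesgue_rV_type R N)).
  have := mu_u mQ [set` I] (measurable_itv I).
  by congr (measurable _).
have mA : measurable A.
  suff -> : A = [set x | cube x0 r x /\ u x \in `]c, +oo[] by exact: mlev.
  by apply/seteqP; split=> x /=; rewrite in_itv/= andbT.
have mcell k := @measurable_cell R N x0 r m k.
have mBk k : measurable (Bk k).
  apply: measurableI => //.
  suff -> : [set x | cube x0 r x /\ u x <= lambda * c] =
    [set x | cube x0 r x /\ u x \in `]-oo, lambda * c]] by exact: mlev.
  by apply/seteqP; split=> x /=; rewrite in_itv.
have mCk k : measurable (Ck k).
  apply: measurableI => //.
  suff -> : [set x | cube x0 r x /\ lambda * c < u x] =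
    [set x | cube x0 r x /\ u x \in `]lambda * c, +oo[] by exact: mlev.
  by apply/seteqP; split=> x /=; rewrite in_itv/= andbT.
have mAk k : measurable (Ak k) by exact: measurableI.
have fin (S : set (lebesgue_rV_type R N)) : measurable S -> S `<=` cube x0 r ->
    lebesgue_rV R N S \is a fin_num.
  move=> mS SQ; rewrite ge0_fin_numE//.
  apply: (le_lt_trans _ (lebesgue_cube_fin x0 r0)).
  exact: (le_measure _ (mem_set mS) (mem_set mQ) SQ).
have csub k := @cell_sub R N x0 r m r0 k.
pose mu S := fine (lebesgue_rV R N S).
have mu0 S : 0 <= mu S by exact: fine_ge0.
have cell_mu (k : {ffun 'I_N -> 'I_m.+1}) : mu (cell x0 r k) = mesh r m ^+ N.
  by rewrite /mu /cell lebesgue_cube.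
have splitBC k : mu (Bk k) + mu (Ck k) = mesh r m ^+ N.
  rewrite -(cell_mu k) /mu -fineD; first last.
  - by apply: fin => // x [/csub].
  - by apply: fin => // x [/csub].
  congr fine; rewrite -measureU//; last first.
    apply/seteqP; split => // x [[_ [_ h1]] [_ [_ h2]]].
    by move: (le_lt_trans h1 h2); rewrite ltxx.
  congr (lebesgue_rV R N _); apply/seteqP; split=> [x [[]|[]]//|x kx].
  have Qx := csub _ _ kx.
  by have [h|h] := leP (u x) (lambda * c); [left|right].
(* The failure is used at x1 the center of cell k, where the set of the conclusion is [Ck k]; its
   complement in the cell is [Bk k]. *)
have Bbig k : delta * mesh r m ^+ N <= mu (Bk k).
  have : ~ ((((1 - delta) * mesh r m ^+ N)%:E < lebesgue_rV R N (Ck k))%E).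
    move=> h; apply: none; exists (cell_center x0 r k); first exact: cell_center_in.
    apply: (lt_le_trans h); rewrite le_eqVlt; apply/orP; left; apply/eqP.
    congr (lebesgue_rV R N _); apply/seteqP.
    by split=> [x [? [? ?]]|x [? ? ?]].
  move/negP; rewrite -leNgt -[leLHS]fineK; last by apply: fin => // x [/csub].
  rewrite lee_fin -/(mu _); move: (splitBC k); lra.
(* Since lambda c < c, [Ak k] lies in [Ck k], which is disjoint from [Bk k]. *)
have ABle k : mu (Ak k) + mu (Bk k) <= mesh r m ^+ N.
  rewrite -(splitBC k) addrC lerD2l; apply: fine_le.
  - by apply: fin => // x [_ /csub].
  - by apply: fin => // x [/csub].
  apply: le_measure; rewrite ?inE//.
  move=> x [[Qx ux] kx]; split=> //; split=> //.
  by rewrite (lt_trans _ ux)// gtr_pMl.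
pose Gk (k : {ffun 'I_N -> 'I_m.+1}) :=
  \sum_i \int[lebesgue_rV R N]_(y in cell x0 r k) `|G y ord0 i|.
have Gk0 k : 0 <= Gk k by apply: sumr_ge0 => i _; exact: Rintegral_ge0.
(* In the isoperimetric inequality |B_k| is bounded below by delta l^N and |A_k| + |B_k| above by
   l^N; the factor l^N cancels. *)
have local k : mu (Ak k) * (delta * (1 - lambda) * c) <= K * mesh r m * Gk k.
  have iuk : (lebesgue_rV R N).-integrable (cell x0 r k) (EFin \o u).
    exact: integrableS iu.
  have iGk i : (lebesgue_rV R N).-integrable (cell x0 r k) (EFin \o (fun y => G y ord0 i)).
    exact: integrableS (iG i).
  have := levels (cell_center x0 r k) (mesh r m) u (fun i y => G y ord0 i)
    (Ak k) (Bk k) c (lambda * c) l0 iuk iGk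
    (fun i phi tphi => weak_partial_sub (csub k) (wG i) tphi)
    (mAk k) (mBk k).
  rewrite -/(mu (Ak k)) -/(mu (Bk k)) -/(Gk k) => /(_ _ _ _ _) H.
  have {H} : mu (Ak k) * mu (Bk k) * (c - lambda * c) <=
      (mu (Ak k) + mu (Bk k)) * (K * mesh r m * Gk k).
    apply: H.
    - by move=> x [].
    - by move=> x [].
    - by move=> x [[_ /ltW]].
    - by move=> x [_ []].
  move=> H; have lN : 0 < mesh r m ^+ N by exact: exprn_gt0.
  rewrite -(ler_pM2l lN).
  have X0 : 0 <= K * mesh r m * Gk k by rewrite !mulr_ge0// ltW.
  apply: le_trans (ler_wpM2r X0 (ABle k)).
  apply: le_trans H.
  have -> : mesh r m ^+ N * (mu (Ak k) * (delta * (1 - lambda) * c)) =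
      mu (Ak k) * (delta * mesh r m ^+ N) * (c - lambda * c) by ring.
  rewrite ler_wpM2r//; last by rewrite ler_wpM2l.
  by rewrite subr_ge0 ler_piMl// ltW.
have sumA : alpha * r ^+ N < \sum_k mu (Ak k).
  rewrite -lte_fin -sumEFin; apply: (lt_le_trans hA).
  have -> : (\sum_k (mu (Ak k))%:E =
      \sum_(k : {ffun 'I_N -> 'I_m.+1}) lebesgue_rV R N (A `&` cell x0 r k))%E.
    by apply: eq_bigr => k _; rewrite /mu fineK//; apply: fin => // x [[]].
  by apply: measure_le_cells => // x [].
have sumG : \sum_k Gk k <= N%:R * (2 * (gamma' * c) * r ^+ N / r).
  rewrite /Gk exchange_big/=.
  apply: (@le_trans _ _ (\sum_(i < N) (2 * (gamma' * c) * r ^+ N / r))).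
    apply: ler_sum => i _.
    by apply: le_trans (boundG i); exact: sum_cells_integral.
  by rewrite sumr_const card_ord -[leLHS]mulr_natl.
have total := ler_sum (index_enum _) (fun k (_ : true) => local k).
rewrite -mulr_suml -mulr_sumr in total.
have dc0 : 0 < delta * (1 - lambda) * c by rewrite !mulr_gt0 ?subr_gt0.
have Kl0 : 0 < K * mesh r m by rewrite mulr_gt0.
have rN0 : 0 < r ^+ N by exact: exprn_gt0.
have fin1 : alpha * r ^+ N * (delta * (1 - lambda) * c) <
    K * mesh r m * (N%:R * (2 * (gamma' * c) * r ^+ N / r)).
  apply: (@lt_le_trans _ _ ((\sum_k mu (Ak k)) * (delta * (1 - lambda) * c))).
    by rewrite ltr_pM2r.
  by apply: (le_trans total); rewrite ler_pM2l.
move: mT; rewrite ltNge => /negP; apply.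
rewrite /T ler_pdivlMr// ltW//.
have m0 : (0 : R) < m.+1%:R by [].
(* Multiplication by c r^N / (m+1) turns the goal into [fin1]. *)
rewrite -(ltr_pM2r (mulr_gt0 c0 (divr_gt0 rN0 m0))).
have -> : m.+1%:R * D * (c * (r ^+ N / m.+1%:R)) = alpha * r ^+ N * (delta * (1 - lambda) * c).
  by rewrite /D; field; rewrite gt_eqF.
have -> // : 2 * K * N%:R * gamma' * (c * (r ^+ N / m.+1%:R)) =
    K * mesh r m * (N%:R * (2 * (gamma' * c) * r ^+ N / r)).
rewrite /mesh; field; rewrite !gt_eqF//.
Qed.
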